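(* Let $A\in\mathrm{SL}_2(\mathbb{Z})$ with $A\ne I_2$ and let $G_A=\mathbb{Z}^2\rtimes_A\mathbb{Z}$. Suppose that $G_A$ acts on a compact manifold $M$ by Lipschitz homeomorphisms (respectively, by $C^2$-diffeomorphisms). Let $g\in\mathbb{Z}^2$, where $g$ is an arbitrary element if $|\mathrm{tr}(A)|>2$, and $g$ is an eigenvector of $A$ if $|\mathrm{tr}(A)|=2$. Then the topological entropy $h_{top}(g)$ is $0$ (respectively, the Lyapunov exponents of $g$ are zero).
   Context: In $\mathbb{Z}^2\rtimes_A\mathbb{Z}$ a generator $t$ of $\mathbb{Z}$ acts on $\mathbb{Z}^2$ by $tvt^{-1}=Av$. The compact manifold $M$ is Riemannian, with distance $d$; a homeomorphism $f:M\to M$ is Lipschitz if $\sup_{x\neq y} d(fx,fy)/d(x,y)<\infty$. For a diffeomorphism $f$ of $M$ and an $f$-invariant Borel probability measure $\mu$, there is a measurable set $\Gamma_f\subset M$ with $\mu(\Gamma_f)=1$ such that for all $x\in\Gamma_f$ and all nonzero $u\in T_xM$ the limit $\chi(x,u,f)=\lim_{n\to\infty}\frac1n\log\|D_xf^n(u)\|$ exists; the numbers $\chi(x,u,f)$ are the Lyapunov exponents of $f$.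
   Formalization: The case A = -I_2 is excluded in addition to A = I_2: there every nonzero g is an eigenvector and the claim fails, e.g. B=[[2,1],[1,1]] and J=[[0,-1],[1,0]] satisfy JBJ^{-1}=B^{-1}, giving an action on the 2-torus in which g=(1,0) acts by the hyperbolic map B. *)

(* Defs.v *)
From HB Require Import structures.
From mathcomp Require Import all_boot all_order all_algebra.
From mathcomp Require Import all_classical all_reals all_analysis.
Set Implicit Arguments.
Unset Strict Implicit.
Unset Printing Implicit Defensive.
Import Order.TTheory GRing.Theory Num.Theory.
Import numFieldNormedType.Exports.
Local Open Scope classical_set_scope.
Local Open Scope ring_scope.

Record SL2Z := MkSL2Z { sl2_mx :> 'M[int]_2 ; sl2_det : \det sl2_mx = 1 }.

(* Z^2 ><|_A Z: the pair (v, k) is v t^k, and Z^2 consists of column vectors. *)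
Definition sdZ (A : SL2Z) : Type := ('cV[int]_2 * int)%type.

Section SemidirectProduct.
Variable A : SL2Z.
Implicit Types x y : sdZ A.

HB.instance Definition _ := Choice.on (sdZ A).

Definition sdZ_mul x y : sdZ A := (x.1 + (sl2_mx A ^ x.2) *m y.1, x.2 + y.2).
Definition sdZ_one : sdZ A := (0, 0).
Definition sdZ_inv x : sdZ A := (- ((sl2_mx A ^ (- x.2)) *m x.1), - x.2).

Lemma sl2_unit : sl2_mx A \is a GRing.unit.
Proof. by rewrite unitmxE sl2_det unitr1. Qed.

Lemma sdZ_mulA : associative sdZ_mul.
Proof.
move=> [u k] [v l] [w m]; rewrite /sdZ_mul /=; congr pair; last by rewrite addrA.
by rewrite mulmxDr mulmxA mulmxE -(exprzDr sl2_unit) addrA.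
Qed.

Lemma sdZ_mul1g : left_id sdZ_one sdZ_mul.
Proof. by move=> [u k]; rewrite /sdZ_mul /= expr0z mul1mx !add0r. Qed.

Lemma sdZ_mulg1 : right_id sdZ_one sdZ_mul.
Proof. by move=> [u k]; rewrite /sdZ_mul /= mulmx0 !addr0. Qed.

Lemma sdZ_mulVg : left_inverse sdZ_one sdZ_inv sdZ_mul.
Proof. by move=> [u k]; rewrite /sdZ_mul /= !addNr. Qed.

Lemma sdZ_mulgV : right_inverse sdZ_one sdZ_inv sdZ_mul.
Proof.
move=> [u k]; rewrite /sdZ_mul /= mulmxN mulmxA mulmxE -(exprzDr sl2_unit).
by rewrite !subrr expr0z mul1mx subrr.
Qed.

HB.instance Definition _ :=
  isGroup.Build (sdZ A) sdZ_mulA sdZ_mul1g sdZ_mulg1 sdZ_mulVg sdZ_mulgV.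

Definition sdZ_vec (v : 'cV[int]_2) : sdZ A := (v, 0).
Definition sdZ_t : sdZ A := (0, 1).

Lemma sdZ_conj (v : 'cV[int]_2) :
  (sdZ_t * sdZ_vec v * sdZ_t^-1)%g = sdZ_vec (sl2_mx A *m v).
Proof.
change (sdZ_mul (sdZ_mul sdZ_t (sdZ_vec v)) (sdZ_inv sdZ_t) = sdZ_vec (A *m v)).
rewrite /sdZ_mul /sdZ_inv /sdZ_vec /sdZ_t /=.
by rewrite expr1z add0r !mulmx0 oppr0 mulmx0 !addr0 subrr.
Qed.
End SemidirectProduct.

Definition is_eigenvector (A : 'M[int]_2) (v : 'cV[int]_2) :=
  v <> 0 /\ exists a : int, A *m v = a *: v.

Definition is_action (G : groupType) (M : Type) (rho : G -> M -> M) :=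
  (forall x, rho 1%g x = x) /\
  (forall a b x, rho (a * b)%g x = rho a (rho b x)).

(* f is of class C^k on the open set U. *)
Fixpoint Ck_on (R : realType) (V W : normedModType R) (k : nat)
    (U : set V) (f : V -> W) : Prop :=
  if k is k'.+1 then
    (forall x, U x -> differentiable f x) /\
    (forall v, Ck_on k' U (fun x => 'D_v f x))
  else forall x, U x -> {for x, continuous f}.

Definition smooth_on (R : realType) (V W : normedModType R)
    (U : set V) (f : V -> W) := forall k, Ck_on k U f.

(* Values of chart_map (resp. chart_inv) outside chart_dom (resp. outside the *)
(* image of chart_dom) are irrelevant.                                        *)
Record chart (R : realType) (n : nat) (M : topologicalType) := MkChart {
  chart_dom : set M ;
  chart_map : M -> 'rV[R]_n ;
  chart_inv : 'rV[R]_n -> M ;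
  chart_dom_open : open chart_dom ;
  chart_cod_open : open (chart_map @` chart_dom) ;
  chart_mapK : forall x, chart_dom x -> chart_inv (chart_map x) = x ;
  chart_map_cont : forall x, chart_dom x -> {for x, continuous chart_map} ;
  chart_inv_cont :
    forall y, (chart_map @` chart_dom) y -> {for y, continuous chart_inv} }.

(* Smooth n-manifold without boundary.  The atlas need not be maximal.  A     *)
(* preferred chart at x is part of the data: it identifies T_xM with R^n, so  *)
(* that tangent vectors at x are row vectors.                                 *)
Record manifold (R : realType) (n : nat) (M : topologicalType) := MkManifold {
  mf_hausdorff : hausdorff_space M ;
  mf_index : Type ;
  mf_chart : mf_index -> chart R n M ;
  chart_at : M -> mf_index ;
  mem_chart_at : forall x, chart_dom (mf_chart (chart_at x)) x ;
  mf_compat : forall i j,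
    smooth_on
      (chart_map (mf_chart i) @`
         (chart_dom (mf_chart i) `&` chart_dom (mf_chart j)))
      (chart_map (mf_chart j) \o chart_inv (mf_chart i)) }.

Arguments mf_chart {R n M} m i : rename.
Arguments chart_at {R n M} m x : rename.

Section Calculus.
Variables (R : realType) (n : nat) (M : topologicalType).
Variable X : manifold R n M.

Definition loc (x : M) : chart R n M := mf_chart X (chart_at X x).

Definition Ck_map (k : nat) (f : M -> M) :=
  continuous f /\
  forall i j : mf_index X,
    let c := mf_chart X i in let c' := mf_chart X j in
    Ck_on k (chart_map c @` (chart_dom c `&` f @^-1` chart_dom c'))
      (chart_map c' \o f \o chart_inv c).

Definition Ck_diffeo (k : nat) (f : M -> M) :=
  exists h, [/\ cancel f h, cancel h f, Ck_map k f & Ck_map k h].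

(* D_xf : T_xM -> T_(f x)M *)
Definition tangent_map (f : M -> M) (x : M) (u : 'rV[R]_n) : 'rV[R]_n :=
  'd (chart_map (loc (f x)) \o f \o chart_inv (loc x)) (chart_map (loc x) x) u.

(* The vector of T_xM whose coordinates in the chart i are u. *)
Definition of_chart (i : mf_index X) (x : M) (u : 'rV[R]_n) : 'rV[R]_n :=
  'd (chart_map (loc x) \o chart_inv (mf_chart X i))
     (chart_map (mf_chart X i) x) u.

Definition C1_curve (c : R -> M) :=
  continuous c /\
  forall i : mf_index X,
    Ck_on 1 (c @^-1` chart_dom (mf_chart X i)) (chart_map (mf_chart X i) \o c).

(* c'(t) in T_(c t)M *)
Definition velocity (c : R -> M) (t : R) : 'rV[R]_n :=
  'D_1 (chart_map (loc (c t)) \o c) t.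
End Calculus.

Record riemannian (R : realType) (n : nat) (M : topologicalType) :=
  MkRiemannian {
  rm_manifold :> manifold R n M ;
  (* Gram matrix of the inner product on T_xM *)
  rm_gram : M -> 'M[R]_n ;
  rm_sym : forall x, (rm_gram x)^T = rm_gram x ;
  rm_pos : forall x (u : 'rV[R]_n), u != 0 -> 0 < (u *m rm_gram x *m u^T) 0 0 ;
  rm_smooth : forall (i : mf_index rm_manifold) (u v : 'rV[R]_n),
    let c := mf_chart rm_manifold i in
    smooth_on (chart_map c @` chart_dom c)
      (fun y => let x := chart_inv c y in
        (of_chart i x u *m rm_gram x *m (of_chart i x v)^T) 0 0) }.

(* M is pointed, hence nonempty: no entropy is assigned to the empty space. *)
Section Dynamics.
Variables (R : realType) (n : nat) (M : ptopologicalType).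
Variable X : riemannian R n M.

Definition tangent_norm (x : M) (u : 'rV[R]_n) : R :=
  Num.sqrt ((u *m rm_gram X x *m u^T) 0 0).

Definition curve_length (c : R -> M) : \bar R :=
  (\int[lebesgue_measure]_(t in `[0%R, 1%R])
     (tangent_norm (c t) (velocity X c t))%:E)%E.

(* The Riemannian distance; it is +oo between distinct components of M. *)
Definition rm_dist (x y : M) : \bar R :=
  ereal_inf [set curve_length c | c in
    [set c : R -> M | [/\ C1_curve X c, c 0 = x & c 1 = y]]].

(* In \bar R, a / +oo = 0, so pairs of points in distinct components do not   *)
(* contribute to this supremum.                                               *)
Definition lipschitz_map (f : M -> M) : Prop :=
  (ereal_sup [set rm_dist (f p.1) (f p.2) / rm_dist p.1 p.2 |
              p in [set p : M * M | p.1 <> p.2]] < +oo)%E.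

Definition lipschitz_homeo (f : M -> M) :=
  exists h, [/\ cancel f h, cancel h f, continuous f, continuous h
              & lipschitz_map f].

(* Bowen's definition of the topological entropy, by separated sets. *)
Definition bowen_dist (f : M -> M) (m : nat) (x y : M) : \bar R :=
  \big[maxe/0%E]_(i < m) rm_dist (iter i f x) (iter i f y).

Definition separated (f : M -> M) (m : nat) (e : R) (s : seq M) : Prop :=
  uniq s /\ forall x y, x \in s -> y \in s -> x <> y ->
    (e%:E < bowen_dist f m x y)%E.

Definition separated_num (f : M -> M) (m : nat) (e : R) : \bar R :=
  ereal_sup [set (size s)%:R%:E | s in [set s | separated f m e s]].

Definition entropy_at (f : M -> M) (e : R) : \bar R :=
  limn_esup (fun m => (m%:R^-1)%:E * lne (separated_num f m e))%E.

Definition htop (f : M -> M) : \bar R := lim (entropy_at f e @[e --> 0^'+]).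

Definition borel : Type := g_sigma_algebraType (@open M).

Definition invariant_measure (f : M -> M) (mu : set borel -> \bar R) :=
  forall B : set borel, measurable B -> mu (f @^-1` B) = mu B.

Definition lyapunov_seq (f : M -> M) (x : M) (u : 'rV[R]_n) : R^nat :=
  fun m => m%:R^-1 *
    ln (tangent_norm (iter m f x) (tangent_map X (iter m f) x u)).

Definition lyapunov_exponent (f : M -> M) (x : M) (u : 'rV[R]_n) : R :=
  limn (lyapunov_seq f x u).

Definition lyapunov_domain (f : M -> M) (mu : set borel -> \bar R)
    (Gamma : set borel) :=
  [/\ measurable Gamma, mu Gamma = 1%E &
      forall x, Gamma x -> forall u, u <> 0 -> cvgn (lyapunov_seq f x u)].

Definition zero_lyapunov_exponents (f : M -> M) :=
  forall mu : probability borel R, invariant_measure f mu ->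
    (exists Gamma, lyapunov_domain f mu Gamma) /\
    (forall Gamma, lyapunov_domain f mu Gamma ->
       forall x, Gamma x -> forall u, u <> 0 -> lyapunov_exponent f x u = 0).
End Dynamics.

(* Main.v *)
Require Import Defs.
From HB Require Import structures.
From mathcomp Require Import all_boot all_order all_algebra.
From mathcomp Require Import all_classical all_reals all_analysis.
From mathcomp Require Import zify ring lra.
Set Implicit Arguments.
Unset Strict Implicit.
Unset Printing Implicit Defensive.
Import Order.TTheory GRing.Theory Num.Theory.
Import numFieldNormedType.Exports.
Local Open Scope classical_set_scope.
Local Open Scope ring_scope.

(** The element g is distorted in the group: g^m is a product of o(m)
    generators.  If |tr A| > 2, then A^k + A^-k = tr(A^k) I by Cayley-Hamilton,
    so the multiple tr(A^k) g, whose size grows exponentially with k, is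
    t^k g t^-k . t^-k g t^k, of length O(k).  If |tr A| = 2 and A is not I or
    -I, then A = s I + N with s = 1 or -1, N^2 = 0 and N v = q g for some
    vector v and some integer q <> 0; up to signs, k v and its conjugate by t^k
    then differ by k^2 q g, again of length O(k).  In both cases some power g^p
    with p >= k^2 has length O(k), so for every e > 0 there is a C such that g^m
    has length at most C + e m for all m.

    Any quantity that is subadditive on the group therefore grows slower than
    linearly along the powers of g ([distortion]).  This applies to two
    quantities.

    For an action by Lipschitz maps, it applies to the logarithm of the
    Lipschitz constant: the m-th iterate of g multiplies distances by at
    most e^(o(m)).  A set that is (m, r)-separated for g is then separated by
    r e^(-o(m)) for d, and a compact n-manifold contains at most C / d^n points
    at mutual distances greater than d ([rm_packing]).  The logarithm of the
    cardinality of the set is therefore o(m), and the entropy is 0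
    ([htop_subexp]).

    For an action by C^1 diffeomorphisms, it applies to the logarithm of the
    supremum over M of the norm of the derivative, which is finite by
    compactness ([tangent_bound]): the derivative of the m-th iterate of g
    multiplies norms by at most e^(o(m)), and so does that of its inverse,
    because -g satisfies the same hypothesis as g.  Hence (1/m) log |D g^m u|
    tends to 0 at every point and for every u <> 0, whatever the measure
    ([lyapunov_subexp]). *)

(** * Distortion in the semidirect product *)

(** Such a P stands for a subadditive function l on the group, P a x being the
    inequality l a <= x.  Working with upper bounds avoids choosing
    a best constant for each a. *)
Definition subadditive_bound (R : realType) (G : groupType) (P : G -> R -> Prop) :=
  [/\ P 1%g 0,
      forall a b x y, P a x -> P b y -> P (a * b)%g (x + y),
      forall a x y, x <= y -> P a x -> P a y
    & forall a, exists x, P a x].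

Section Distortion.
Variable A : SL2Z.
Implicit Types (u v g : 'cV[int]_2) (k N : nat).

Lemma sdZ_vecD u v : sdZ_vec A (u + v) = (sdZ_vec A u * sdZ_vec A v)%g.
Proof.
change (sdZ_vec A (u + v) = sdZ_mul (sdZ_vec A u) (sdZ_vec A v)).
by rewrite /sdZ_mul /sdZ_vec /= expr0z mul1mx addr0.
Qed.

Lemma det_mx2 (B : 'M[int]_2) : \det B = B 0 0 * B 1 1 - B 0 1 * B 1 0.
Proof.
rewrite (expand_det_row _ ord0) !big_ord_recl big_ord0 addr0 /cofactor !det_mx11.
rewrite !mxE /= expr0 mul1r expr1 mulN1r mulrN; congr (_ * B _ _ - B _ _ * B _ _);
by apply/val_inj.
Qed.

(** The inverse of A, as a polynomial in A: det A = 1, so that it is also the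
    adjugate of A. *)
Definition sl2_adj : 'M[int]_2 := (\tr (sl2_mx A))%:M - sl2_mx A.

Lemma sl2_mulV : sl2_mx A *m sl2_adj = 1%:M.
Proof.
have := sl2_det A; rewrite det_mx2 => hd.
apply/matrixP => i j; rewrite !mxE !big_ord_recl big_ord0 !mxE /mxtrace.
rewrite !big_ord_recl big_ord0.
have e1 : lift ord0 ord0 = 1 :> 'I_2 by apply/val_inj.
have e0 : ord0 = 0 :> 'I_2 by apply/val_inj.
rewrite e1 e0.
have [->|->] : i = 0 \/ i = 1 by case: i => -[|[|//]] h; [left|right]; apply/val_inj.
all: have [->|->] : j = 0 \/ j = 1
  by case: j => -[|[|//]] h; [left|right]; apply/val_inj.
all: rewrite /= ?mulr0n ?mulr1n.
all: lia.
Qed.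

Lemma sl2_Vmul : sl2_adj *m sl2_mx A = 1%:M.
Proof. exact: mulmx1C sl2_mulV. Qed.

Lemma sl2_Cayley : sl2_mx A *m sl2_mx A = \tr (sl2_mx A) *: sl2_mx A - 1%:M.
Proof.
rewrite -sl2_mulV /sl2_adj mulmxBr -mul_scalar_mx scalar_mxC.
by rewrite opprB addrC subrK.
Qed.

(** The traces c_k of A^k satisfy c_(k+2) = (tr A) c_(k+1) - c_k with c_0 = 2.
    As |tr A| >= 3, their absolute values increase, and they at least double
    from c_1 on. *)
Lemma hyperbolic_trace_pow k : 2 < `|\tr (sl2_mx A)| ->
  exists2 c : int, sl2_mx A ^+ k + sl2_adj ^+ k = c%:M & (2 ^ k)%:Z <= `|c|.
Proof.
move=> ht; set B := sl2_adj; set T := \tr (sl2_mx A) in ht *.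
suff [c [c' [h1 h2 h3 h4 h5]]] : exists c c' : int,
  [/\ sl2_mx A ^+ k + B ^+ k = c%:M, sl2_mx A ^+ k.+1 + B ^+ k.+1 = c'%:M,
      `|c| <= `|c'|, (2 ^ k)%:Z <= `|c| & (2 ^ k.+1)%:Z <= `|c'| ] by exists c.
elim: k => [|k [c [c' [h1 h2 h3 h4 h5]]]].
  exists 2, T; rewrite !expr0 !expr1; split => //; last first.
  - by rewrite expn1; lia.
  - by lia.
  - by rewrite /B /sl2_adj addrC subrK.
  by rewrite -raddfD.
exists c', (T * c' - c); split=> //; last 2 first.
- have : 3 * `|c'| <= `|T * c'| by rewrite normrM ler_wpM2r //; lia.
  lia.
- have : 3 * `|c'| <= `|T * c'| by rewrite normrM ler_wpM2r //; lia.
  rewrite (expnS 2 k.+1); lia.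
have e : sl2_mx A ^+ k.+2 + B ^+ k.+2 =
    (sl2_mx A + B) * (sl2_mx A ^+ k.+1 + B ^+ k.+1)
    - (sl2_mx A ^+ k + B ^+ k).
  rewrite mulrDl !mulrDr -!exprS.
  have AB : sl2_mx A * B = 1 := sl2_mulV.
  have BA : B * sl2_mx A = 1 := sl2_Vmul.
  have -> : sl2_mx A * B ^+ k.+1 = B ^+ k by rewrite exprS mulrA AB mul1r.
  have -> : B * sl2_mx A ^+ k.+1 = sl2_mx A ^+ k by rewrite exprS mulrA BA mul1r.
  set a := sl2_mx A ^+ k; set b := B ^+ k.
  by rewrite (addrC a (B ^+ _)) addrACA (addrC b a) addrK.
rewrite e h1 h2 {1}/B /sl2_adj [sl2_mx A + _]addrC subrK.
by rewrite -[T%:M * _]scalar_mxM raddfB.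
Qed.

Lemma col_neq0 g : g <> 0 -> exists i, g i 0 != 0.
Proof.
move=> g0; apply: contrapT => h; apply: g0; apply/colP => i; rewrite mxE.
by apply/eqP/negPn/negP => gi; apply: h; exists i.
Qed.

Lemma colinear_int (u v : 'cV[int]_2) : u <> 0 -> v <> 0 ->
  u 0 0 * v 1 0 = u 1 0 * v 0 0 ->
  exists p q : int, p *: u = q *: v /\ q != 0.
Proof.
move=> u0 v0 h.
have ext (x y : 'cV[int]_2) : x 0 0 = y 0 0 -> x 1 0 = y 1 0 -> x = y.
  move=> h0 h1; apply/matrixP => i j; rewrite (ord1 j).
  by have [->|->] : i = 0 \/ i = 1
    by case: i => -[|[|//]] hi; [left|right]; apply/val_inj.
have [v00|v00] := eqVneq (v 0 0) 0.
  have v10 : v 1 0 != 0 by apply/eqP => v10; apply: v0; apply: ext; rewrite !mxE.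
  exists (v 1 0), (u 1 0); split; first by apply: ext; rewrite !mxE mulrC ?h.
  apply/eqP => u10; apply: u0; apply: ext; rewrite !mxE //.
  by move: h; rewrite u10 mul0r => /eqP; rewrite mulf_eq0 (negPf v10) orbF => /eqP.
exists (v 0 0), (u 0 0); split; first by apply: ext; rewrite !mxE mulrC ?h.
apply/eqP => u00; apply: u0; apply: ext; rewrite !mxE //.
by move: h; rewrite u00 mul0r => /esym/eqP; rewrite mulf_eq0 (negPf v00) orbF => /eqP.
Qed.

(** By Cayley-Hamilton a^2 - (tr A) a + 1 = 0 for the eigenvalue a, and this
    quadratic has a double root when tr A = 2 or tr A = -2. *)
Lemma parabolic_eigenvalue g : `|\tr (sl2_mx A)| = 2 -> is_eigenvector A g ->
  exists s : int, [/\ `|s| = 1, \tr (sl2_mx A) = 2 * s & sl2_mx A *m g = s *: g].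
Proof.
move=> ht [g0 [a ha]]; exists a.
have : (a * a - \tr (sl2_mx A) * a + 1) *: g = 0.
  rewrite scalerDl scalerBl scale1r -!scalerA -ha (scalemxAr a) -ha mulmxA.
  by rewrite sl2_Cayley mulmxBl mul1mx -scalemxAl addrAC subrK subrr.
have [i gi] := col_neq0 g0.
move=> /colP/(_ i)/eqP; rewrite !mxE mulf_eq0 (negPf gi) orbF => /eqP h.
have [e|e] : \tr (sl2_mx A) = 2 \/ \tr (sl2_mx A) = -2 by lia.
  by rewrite e in h *; split=> //; nia.
by rewrite e in h *; split=> //; nia.
Qed.

(** The matrix N = A - s I is nonzero with N^2 = 0.  A nonzero column of N and
    the vector g both lie in the kernel of N, which is a line, so that a multiple
    of this column is a nonzero multiple of g. *)
Lemma parabolic_shear g : sl2_mx A <> 1%:M -> sl2_mx A <> - 1%:M ->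
  `|\tr (sl2_mx A)| = 2 -> is_eigenvector A g ->
  exists s q v, [/\ `|s| = 1, q != 0, sl2_mx A *m g = s *: g &
                 sl2_mx A *m v = s *: v + q *: g].
Proof.
move=> hA1 hAN ht hg; have [s [hs ets hAg]] := parabolic_eigenvalue ht hg.
pose N := sl2_mx A - s%:M.
have N0 : N != 0.
  apply/eqP => /subr0_eq e; have [h|h] : s = 1 \/ s = -1 by lia.
    by apply: hA1; rewrite e h.
  by apply: hAN; rewrite e h raddfN.
have NN : N *m N = 0.
  rewrite /N mulmxBl !mulmxBr sl2_Cayley ets -scalar_mxM.
  rewrite mul_mx_scalar mul_scalar_mx (_ : s * s = 1); last by lia.
  by rewrite mulr_natl mulr2n scalerDl (addrAC _ _ (- (s *: _))) addrK subrr.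
have Ng : N *m g = 0 by rewrite /N mulmxBl hAg mul_scalar_mx subrr.
have AN : sl2_mx A = N + s%:M by rewrite subrK.
clearbody N.
have [j wj] : exists j, col j N <> 0.
  apply/existsNP => h; move/eqP: N0; apply.
  by apply/matrixP => i j; have /colP/(_ i) := h j; rewrite !mxE.
have Nw : N *m col j N = 0 by rewrite colE mulmxA NN mul0mx.
case: hg => g0 _.
have [p [q [hpq q0]]] : exists p q : int, p *: col j N = q *: g /\ q != 0.
  apply: colinear_int => //.
  have hk (w : 'cV[int]_2) : N *m w = 0 -> forall i, N i 0 * w 0 0 + N i 1 * w 1 0 = 0.
    move=> /colP h i; have := h i; rewrite !mxE !big_ord_recl big_ord0 addr0.
    by have -> : lift ord0 ord0 = 1 :> 'I_2 by apply/val_inj.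
  have [i] := col_neq0 wj; rewrite mxE => nij.
  have hu := hk _ Nw i; have hv := hk _ Ng i.
  set u := col j N in hu *.
  have {}nij : (N i 0 != 0) || (N i 1 != 0).
    have [e|e] : j = 0 \/ j = 1
      by case: (j) => -[|[|//]] hj; [left|right]; apply/val_inj.
      by rewrite -e nij.
    by rewrite -e nij orbT.
  apply/eqP; rewrite -subr_eq0.
  case/orP: nij => ni; rewrite -(mulrI_eq0 _ (mulfI ni)); apply/eqP.
    rewrite (_ : N i 0 * (_ - _) = g 1 0 * (N i 0 * u 0 0 + N i 1 * u 1 0)
               - u 1 0 * (N i 0 * g 0 0 + N i 1 * g 1 0)); last by ring.
    by rewrite hu hv !mulr0 subrr.
  rewrite (_ : N i 1 * (_ - _) = u 0 0 * (N i 0 * g 0 0 + N i 1 * g 1 0)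
             - g 0 0 * (N i 0 * u 0 0 + N i 1 * u 1 0)); last by ring.
  by rewrite hu hv !mulr0 subrr.
exists s, q, (p *: delta_mx j 0); split=> //.
rewrite AN mulmxDl mul_scalar_mx addrC; congr (_ + _).
by rewrite -scalemxAr -colE.
Qed.

Lemma shear_pow s q g v k : `|s| = 1 -> sl2_mx A *m g = s *: g ->
  sl2_mx A *m v = s *: v + q *: g ->
  sl2_mx A ^+ k *m v = s ^+ k *: (v + (k%:Z * s * q) *: g).
Proof.
move=> hs hg hv.
have ss : s * s = 1 by lia.
elim: k => [|k IH]; first by rewrite !expr0 mul1mx scale1r !mul0r scale0r addr0.
rewrite exprS -mulmxA IH -scalemxAr mulmxDr -scalemxAr hg hv exprSr -scalerA.
congr (_ *: _); rewrite scalerDr -addrA; congr (_ + _).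
rewrite !scalerA -scalerDl; congr (_ *: _).
by rewrite -addn1 PoszD; nia.
Qed.

Variables (R : realType) (P : sdZ A -> R -> Prop).
Hypothesis hP : subadditive_bound P.
Implicit Types (x y : R).

Lemma bound_vecD u v x y :
  P (sdZ_vec A u) x -> P (sdZ_vec A v) y -> P (sdZ_vec A (u + v)) (x + y).
Proof. by case: hP => _ hM _ _ hu hv; rewrite sdZ_vecD; exact: hM. Qed.

Lemma bound_vecMn u x k :
  P (sdZ_vec A u) x -> P (sdZ_vec A (u *+ k)) (x *+ k).
Proof.
move=> hu; elim: k => [|k IH]; last by rewrite !mulrS; exact: bound_vecD.
by rewrite !mulr0n; case: hP => h1 _ _ _.
Qed.

(** Conjugation by t^k or t^-k costs O(k): this is where the action of A on Z^2
    becomes cheap in the group. *)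
Lemma bound_conj : exists2 c : R, 0 <= c & forall v x k, P (sdZ_vec A v) x ->
  P (sdZ_vec A ((sl2_mx A ^+ k) *m v)) (x + c *+ k) /\
  P (sdZ_vec A ((sl2_adj ^+ k) *m v)) (x + c *+ k).
Proof.
case: hP => h1 hM hmono hex.
have [y hy] := hex (sdZ_t A); have [z hz] := hex (sdZ_t A)^-1%g.
exists (`|y| + `|z|); first exact: addr_ge0.
have step v x : P (sdZ_vec A v) x ->
    P (sdZ_vec A (sl2_mx A *m v)) (x + (`|y| + `|z|)) /\
    P (sdZ_vec A (sl2_adj *m v)) (x + (`|y| + `|z|)).
  move=> hv.
  have ly := ler_norm y; have lz := ler_norm z.
  split; last first.
    have -> : sdZ_vec A (sl2_adj *m v) =
        ((sdZ_t A)^-1 * sdZ_vec A v * sdZ_t A)%g.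
      rewrite -{2}[v]mul1mx -sl2_mulV -mulmxA -sdZ_conj.
      by rewrite !mulgA mulVg mul1g -mulgA mulVg mulg1.
    by apply: (hmono _ _ _ _ (hM _ _ _ _ (hM _ _ _ _ hz hv) hy)); lra.
  rewrite -sdZ_conj.
  by apply: (hmono _ _ _ _ (hM _ _ _ _ (hM _ _ _ _ hy hv) hz)); lra.
move=> v x k hv; elim: k => [|k [IH1 IH2]].
  by rewrite !expr0 !mul1mx mulr0n addr0.
rewrite !exprS -!mulmxA mulrSr addrA; split.
  exact: (step _ _ IH1).1.
exact: (step _ _ IH2).2.
Qed.

Lemma bound_signs v : exists2 x : R, 0 <= x &
  forall s : int, `|s| = 1 -> P (sdZ_vec A (s *: v)) x.
Proof.
case: hP => _ _ hmono hex.
have [x hx] := hex (sdZ_vec A v); have [y hy] := hex (sdZ_vec A (- v)).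
exists (`|x| + `|y|) => [|s hs]; first exact: addr_ge0.
have lx := ler_norm x; have ly := ler_norm y.
have nx := normr_ge0 x; have ny := normr_ge0 y.
have [->|->] : s = 1 \/ s = -1 by lia.
  by rewrite scale1r; apply: hmono hx; lra.
by rewrite scaleN1r; apply: hmono hy; lra.
Qed.

(** The multiple is |tr(A^(2k))| g, the product of two conjugates of g or of
    -g. *)
Lemma hyperbolic_short_multiple g : 2 < `|\tr (sl2_mx A)| ->
  exists C : R, forall k, exists2 N, (k ^ 2 <= N)%N &
    P (sdZ_vec A (g *+ N)) (C * k.+1%:R).
Proof.
move=> ht; have [c c0 hc] := bound_conj; have [x x0 hx] := bound_signs g.
exists (2 * x + 4 * c) => k.
(* The exponent is 2 k because 2^(2k) >= k^2, while 2^3 < 3^2. *)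
have [e he hle] := hyperbolic_trace_pow (2 * k) ht.
exists `|e|%N.
  have : (k ^ 2 <= 2 ^ (2 * k))%N.
    by rewrite [(2 * k)%N]mulnC expnM leq_exp2r // ltnW // ltn_expl.
  lia.
have hs : `|sgz e| = 1.
  have : (0 < 2 ^ (2 * k))%N by rewrite expn_gt0.
  by case: (sgzP e) => //; lia.
have -> : g *+ `|e|%N = sl2_mx A ^+ (2 * k) *m (sgz e *: g) +
                        sl2_adj ^+ (2 * k) *m (sgz e *: g).
  rewrite -mulmxDl he mul_scalar_mx scalerA -scaler_nat; congr (_ *: _).
  by rewrite natz abszE; case: (sgzP e); lia.
have [h1 _] := hc _ _ (2 * k)%N (hx _ hs).
have [_ h2] := hc _ _ (2 * k)%N (hx _ hs).
case: hP => _ _ hmono _; apply: hmono (bound_vecD h1 h2).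
rewrite -[c *+ _]mulr_natr natrM -natr1.
have xk : 0 <= x * k%:R by rewrite mulr_ge0.
by clear -xk c0 x0; lra.
Qed.

(** For v as in [parabolic_shear], A^k (k v) = s^k (k v + k^2 s q g).  Moving s^k
    to the other side and choosing the sign of v leaves k^2 |q| g as the difference
    of k v and its image under A^k, up to signs. *)
Lemma parabolic_short_multiple g : sl2_mx A <> 1%:M -> sl2_mx A <> - 1%:M ->
  `|\tr (sl2_mx A)| = 2 -> is_eigenvector A g ->
  exists C : R, forall k, exists2 N, (k ^ 2 <= N)%N &
    P (sdZ_vec A (g *+ N)) (C * k.+1%:R).
Proof.
move=> hA1 hAN ht hg.
have [s [q [v [hs q0 hAg hAv]]]] := parabolic_shear hA1 hAN ht hg.
have [c c0 hc] := bound_conj; have [x x0 hx] := bound_signs v.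
exists (2 * x + c) => k; exists (k ^ 2 * `|q|)%N; first by rewrite leq_pmulr; lia.
(* The sign for which e s q = |q| *)
pose e := s * sgz q.
have he : `|e| = 1 by rewrite /e; case: (sgzP q) q0 => //; lia.
have hek : `|e * s ^+ k| = 1 by rewrite normrM normrX hs expr1n he.
have -> : g *+ (k ^ 2 * `|q|)%N =
    sl2_mx A ^+ k *m (((e * s ^+ k) *: v) *+ k) + ((- e) *: v) *+ k.
  rewrite -[in X in _ *m X]scaler_nat -scalemxAr scaler_nat -mulrnDl.
  rewrite -scalemxAr (shear_pow k hs hAg hAv) scalerA.
  have -> : e * s ^+ k * s ^+ k = e.
    by rewrite -mulrA -exprMn (_ : s * s = 1) ?expr1n ?mulr1 //; lia.
  rewrite scalerDr scaleNr addrAC subrr add0r scalerA mulnC -mulnn mulnA mulrnA.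
  congr (_ *+ _); rewrite -scaler_nat; congr (_ *: _).
  rewrite natz /e PoszM abszE (_ : `|q| = sgz q * q); last by case: (sgzP q); lia.
  by rewrite (_ : s * _ * _ = (s * s) * (sgz q * q * k%:Z)); [nia|ring].
have [h1 _] := hc _ _ k (bound_vecMn k (hx _ hek)).
have h2 := bound_vecMn k (hx (- e) ltac:(by rewrite normrN)).
case: hP => _ _ hmono _; apply: hmono (bound_vecD h1 h2).
rewrite -[c *+ _]mulr_natr -[x *+ _]mulr_natr -natr1.
by clear -c0 x0; lra.
Qed.

(** If some multiple N g costs at most e N, then division of m by N bounds the cost
    of m g by e m plus that of a remainder smaller than N. *)
Lemma sublinear_growth g :
  (exists C : R, forall k, exists2 N, (k ^ 2 <= N)%N &
    P (sdZ_vec A (g *+ N)) (C * k.+1%:R)) ->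
  forall e : R, 0 < e -> exists C : R, forall m,
    P (sdZ_vec A (g *+ m)) (C + e * m%:R).
Proof.
move=> [C hC] e e0.
have [k hk] : exists k : nat, 2 * `|C| / e <= k.+1%:R.
  exists (Num.truncn (2 * `|C| / e)); apply/ltW/truncnS_gt.
have [N hkN hN] := hC k.+1.
case: (hP) => h1 hM hmono hex.
have N0 : (0 < N)%N by apply: leq_trans hkN; rewrite expn_gt0.
have {}hN : P (sdZ_vec A (g *+ N)) (e * N%:R).
  apply: hmono hN.
  have : (k.+1 ^ 2)%:R <= N%:R :> R by rewrite ler_nat.
  rewrite natrX -[k.+2%:R]natr1 => hkN'.
  have k1 : 1 <= k.+1%:R :> R by rewrite ler1n.
  rewrite ler_pdivrMr // in hk.
  have := ler_norm C; set K := k.+1%:R in hk hkN' k1 *; move=> lC.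
  apply: (@le_trans _ _ (e * K ^+ 2)); last by rewrite ler_pM2l.
  have K0 : 0 <= K by apply: le_trans k1.
  have h3 : C * (K + 1) <= `|C| * (K + 1) by rewrite ler_wpM2r ?addr_ge0.
  have h4 : `|C| * 1 <= `|C| * K by rewrite ler_wpM2l.
  have h5 : K * (2 * `|C|) <= K * (K * e) by rewrite ler_wpM2l.
  by clear -h3 h4 h5; lra.
have [x hx] := hex (sdZ_vec A g).
exists (`|x| *+ N) => m; rewrite {1}(divn_eq m N) mulrnDr mulnC mulrnA.
apply: hmono (bound_vecD (bound_vecMn (m %/ N) hN) (bound_vecMn (m %% N) hx)).
rewrite addrC lerD //.
  apply: (@le_trans _ _ (`|x| *+ (m %% N))); first by rewrite ler_wMn2r ?ler_norm.
  by rewrite ler_wpMn2l // ltnW // ltn_mod.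
by rewrite -[leLHS]mulr_natr -mulrA ler_pM2l // -natrM ler_nat mulnC leq_trunc_div.
Qed.

Theorem distortion g : sl2_mx A <> 1%:M -> sl2_mx A <> - 1%:M ->
  2 < `|\tr (sl2_mx A)| \/ `|\tr (sl2_mx A)| = 2 /\ is_eigenvector A g ->
  forall e : R, 0 < e -> exists C : R, forall m,
    P (sdZ_vec A (g *+ m)) (C + e * m%:R).
Proof.
move=> hA1 hAN hg; apply: sublinear_growth.
case: hg => [ht|[ht hg]]; first exact: hyperbolic_short_multiple.
exact: parabolic_short_multiple.
Qed.

End Distortion.

(** * From local to global on a compact space *)

(** Otherwise the complements of the sets that satisfy P form a proper filter; it
    has a cluster point x by compactness, but x has a neighbourhood that satisfies
    P. *)
Lemma compact_local_global (T : topologicalType) (P : set T -> Prop) :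
  P set0 -> (forall U V, U `<=` V -> P V -> P U) ->
  (forall U V, P U -> P V -> P (U `|` V)) ->
  (forall x : T, exists2 U, nbhs x U & P U) ->
  compact [set: T] -> P setT.
Proof.
move=> P0 Pmono PU Ploc cT; apply: contrapT => PT.
pose F := [set B : set T | P (~` B)].
have FF : ProperFilter F.
  split; first by rewrite /F /= setC0.
  split; first by rewrite /F /= setCT.
    by move=> B C hB hC; rewrite /F /= setCI; exact: PU.
  by move=> B C BC; apply: Pmono; exact: subsetC.
have [x [_ clx]] := cT F FF filterT.
have [U Ux PUU] := Ploc x.
have FU : F (~` U) by rewrite /F /= setCK.
by have [y [nUy Uy]] := clx _ _ FU Ux.
Qed.

Lemma continuous_near (T U : topologicalType) (f : T -> U) (x : T) (P : U -> Prop) :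
  {for x, continuous f} -> (\forall z \near f x, P z) -> \forall y \near x, P (f y).
Proof. by move=> cf; exact: cf. Qed.

Lemma near_eq_continuous (T U : topologicalType) (f g : T -> U) (x : T) :
  (\forall y \near x, f y = g y) -> {for x, continuous f} -> {for x, continuous g}.
Proof.
move=> fg cf; rewrite /prop_for /continuous_at -(nbhs_singleton fg).
by apply: cvg_trans cf; exact: near_eq_cvg.
Qed.

(** * Row vectors and quadratic forms *)

Section RowVectors.
Variable (R : realType).

Lemma normr_coord n (u : 'rV[R]_n) k : `|u 0 k| <= `|u|.
Proof.
by rewrite [leRHS]/Num.Def.normr /= mx_normrE; exact: (le_bigmax _ _ (ord0, k)).
Qed.

Lemma normr_rV_le n (u : 'rV[R]_n) (e : R) : 0 <= e ->
  (forall k, `|u 0 k| <= e) -> `|u| <= e.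
Proof.
move=> e0 h; rewrite /Num.Def.normr /= mx_normrE; apply: bigmax_le => //= -[i k] _ /=.
by rewrite (ord1 i).
Qed.

(** Cut the cube of centre p and radius r into cubes of side d: two points in the
    same small cube are at distance at most d, so the number of points is at most
    the number of small cubes. *)
Lemma rV_packing n (T : choiceType) (s : seq T) (phi : T -> 'rV[R]_n)
    (p : 'rV[R]_n) (r d : R) : 0 < d -> 0 <= r -> uniq s ->
  (forall y, y \in s -> `|phi y - p| <= r) ->
  (forall y z, y \in s -> z \in s -> y <> z -> d < `|phi y - phi z|) ->
  (size s)%:R <= (2 * r / d + 1) ^+ n.
Proof.
move=> d0 r0 us hr hd; pose N := Num.truncn (2 * r / d).
have rd0 : 0 <= 2 * r / d by apply: divr_ge0; [exact: mulr_ge0|exact: ltW].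
have hN : N%:R <= 2 * r / d by rewrite truncn_le.
pose a y (k : 'I_n) := (phi y 0 k - p 0 k + r) / d.
have ha y k : y \in s -> 0 <= a y k <= 2 * r / d.
  move=> /hr h; have := le_trans (normr_coord _ k) h.
  rewrite !mxE ler_norml => /andP[h1 h2].
  by rewrite /a divr_ge0 ?ler_pM2r ?invr_gt0 ?(ltW d0) //=; lra.
have hat y k : y \in s -> (Num.truncn (a y k) < N.+1)%N.
  by move=> /(ha y k)/andP[h1 h2]; rewrite ltnS le_truncn.
pose code y : {ffun 'I_n -> 'I_N.+1} := [ffun k => inord (Num.truncn (a y k))].
have icode : {in s &, injective code}.
  move=> y z ys zs /ffunP eqc; apply: contrapT => yz.
  have := hd _ _ ys zs yz; apply/negP; rewrite -leNgt.
  apply: normr_rV_le; first exact: ltW.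
  move=> k; have /(congr1 val) := eqc k; rewrite !ffunE /= !inordK ?hat // => e.
  have /andP[y0 _] := ha _ k ys; have /andP[z0 _] := ha _ k zs.
  have := truncn_itv y0; have := truncn_itv z0; rewrite e -natr1.
  move=> /andP[h1 h2] /andP[h3 h4].
  have : `|a y k - a z k| <= 1 by rewrite ler_norml; lra.
  rewrite /a -mulrBl normrM (gtr0_norm (_ : 0 < d^-1)) ?invr_gt0 //.
  rewrite ler_pdivrMr // mul1r !mxE; apply: le_trans.
  by rewrite le_eqVlt; apply/orP; left; apply/eqP; congr `|_|; lra.
have h : (size s <= N.+1 ^ n)%N.
  rewrite -(size_map code).
  have /card_uniqP <- : uniq (map code s) by rewrite map_inj_in_uniq.
  rewrite -[X in (_ <= _ ^ X)%N](card_ord n) -[X in (_ <= X ^ _)%N](card_ord N.+1).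
  by rewrite -card_ffun max_card.
apply: (@le_trans _ _ (N.+1 ^ n)%:R); first by rewrite ler_nat.
rewrite natrX; apply: lerXn2r; rewrite ?nnegrE ?ler0n ?addr_ge0 //.
by rewrite -natr1 lerD2r.
Qed.

Lemma linear_rV_le n m (f : {linear 'rV[R]_n -> 'rV[R]_m}) (K : R) :
  (forall k, `|f (delta_mx 0 k)| <= K) -> forall u, `|f u| <= n%:R * K * `|u|.
Proof.
move=> hK u; rewrite {1}[u]row_sum_delta linear_sum.
apply: (le_trans (ler_norm_sum _ _ _)).
apply: (@le_trans _ _ (\sum_(k < n) (K * `|u|))).
  apply: ler_sum => k _; rewrite linearZ_LR /= normrZ mulrC.
  by apply: ler_pM => //; exact: normr_coord.
by rewrite sumr_const card_ord -[leLHS]mulr_natl mulrA.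
Qed.

Definition qform n (H : 'M[R]_n) (u : 'rV[R]_n) : R := (u *m H *m u^T) 0 0.

Lemma qformE n (H : 'M[R]_n) u :
  qform H u = \sum_k \sum_j u 0 j * H j k * u 0 k.
Proof.
rewrite /qform mxE; apply: eq_bigr => k _.
by rewrite !mxE mulr_suml.
Qed.

Lemma qform_le n (H : 'M[R]_n) (e : R) : (forall j k, `|H j k| <= e) ->
  forall u, `|qform H u| <= n%:R ^+ 2 * e * `|u| ^+ 2.
Proof.
move=> he u; rewrite qformE; apply: (le_trans (ler_norm_sum _ _ _)).
apply: (@le_trans _ _ (\sum_(k < n) \sum_(j < n) (`|u| * e * `|u|))).
  apply: ler_sum => k _; apply: (le_trans (ler_norm_sum _ _ _)).
  apply: ler_sum => j _; rewrite !normrM.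
  apply: ler_pM => //; try exact: normr_coord.
  by apply: ler_pM => //; exact: normr_coord.
rewrite !sumr_const card_ord -mulrnA -[leLHS]mulr_natl natrM.
rewrite le_eqVlt; apply/orP; left; apply/eqP; ring.
Qed.

(** By homogeneity, c is the minimum of the form on the unit sphere, which is
    compact. *)
Lemma qform_pos n (H : 'M[R]_n) : (forall u, u != 0 -> 0 < qform H u) ->
  exists2 c : R, 0 < c & forall u, c * `|u| ^+ 2 <= qform H u.
Proof.
move=> hpos; pose S := [set u : 'rV[R]_n | `|u| = 1].
have qZ a u : qform H (a *: u) = a ^+ 2 * qform H u.
  by rewrite /qform linearZ /= -!scalemxAl -scalemxAr scalerA !mxE expr2.
have q0 : qform H 0 = 0 by rewrite /qform !mul0mx mxE.
have norm0 (u : 'rV[R]_n) : u != 0 -> S (`|u|^-1 *: u).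
  move=> u0; rewrite /S /= normrZ normfV normr_id mulVf // normr_eq0 //.
have cont : continuous (qform H).
  rewrite (_ : qform H = fun u => \sum_k \sum_j u 0 j * H j k * u 0 k); last first.
    by apply/funext => v; exact: qformE.
  apply: continuous_big => [|k _]; first exact: add_continuous.
  apply: continuous_big => [|j _]; first exact: add_continuous.
  move=> u; have cu l : {for u, continuous (fun v : 'rV[R]_n => v 0 l)}.
    exact: coord_continuous.
  have cH : {for u, continuous (fun=> H j k)} by exact: cst_continuous.
  exact: (continuousM (continuousM (cu j) cH) (cu k)).
have [[v0 Sv0]|S0] := pselect (S !=set0).
  have cS : compact S.
    apply: bounded_closed_compact.
      by exists 1; split => // M M1 u; rewrite /S /= => ->; exact: ltW.
    have -> : S = (@Num.norm _ 'rV[R]_n) @^-1` [set 1] by [].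
    by have /continuous_closedP := @norm_continuous _ 'rV[R]_n; apply; exact: closed_eq.
  have [v /set_mem Sv hv] := @EVT_min_rV R n (qform H) S (ex_intro _ v0 Sv0) cS
     (continuous_subspaceT cont).
  exists (qform H v).
    apply: hpos; apply/eqP => v00; move: Sv.
    by rewrite /S /= v00 normr0 => /esym/eqP; rewrite oner_eq0.
  move=> u; have [->|u0] := eqVneq u 0.
    by rewrite normr0 expr0n mulr0 q0.
  have := hv _ (mem_set (norm0 _ u0)); rewrite qZ exprVn ler_pdivlMl //.
    by rewrite mulrC.
  by rewrite exprn_gt0 // normr_gt0.
(* The unit sphere is empty if n = 0, and then every vector is 0. *)
exists 1 => // u; have [->|/norm0 u0] := eqVneq u 0.
  by rewrite normr0 expr0n mulr0 q0.
by exfalso; apply: S0; eexists; exact: u0.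
Qed.

End RowVectors.

Lemma subr_mxE (V : zmodType) m n (H H' : 'M[V]_(m, n)) a b :
  (H - H') a b = H a b - H' a b.
Proof. by rewrite !mxE. Qed.

Lemma qformB (R : realType) n (H H' : 'M[R]_n) u :
  qform (H - H') u = qform H u - qform H' u.
Proof. by rewrite /qform mulmxBr mulmxBl subr_mxE. Qed.

(** Positive definiteness is an open condition on the matrix of the form. *)
Lemma qform_pos_near (R : realType) n (H : 'M[R]_n) :
  (forall u, u != 0 -> 0 < qform H u) ->
  exists c e : R, [/\ 0 < c, 0 < e & forall H' : 'M[R]_n,
    (forall a b, `|(H' - H) a b| <= e) -> forall u, c * `|u| ^+ 2 <= qform H' u].
Proof.
move=> /qform_pos [c c0 hc].
have n0 : 0 < n%:R ^+ 2 + 1 :> R by rewrite ltr_wpDl ?exprn_ge0.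
exists (c / 2), (c / (2 * (n%:R ^+ 2 + 1))).
split=> [||H' hH u]; rewrite ?divr_gt0 ?mulr_gt0 //.
have := qform_le hH u; rewrite qformB ler_norml => /andP[h _].
have h2 := hc u; set e := c / _ in h.
have he : n%:R ^+ 2 * e * `|u| ^+ 2 <= c / 2 * `|u| ^+ 2.
  rewrite ler_wpM2r ?exprn_ge0 // /e invfM [c * _]mulrA [leLHS]mulrCA.
  rewrite ler_piMr ?divr_ge0 ?(ltW c0) //.
  by rewrite ler_pdivrMr // mul1r lerDl.
by clear -h h2 he; lra.
Qed.

(** * Differentials in charts *)

(** The chain rule for a map that factors only near p, as do the expressions of a
    composite map in charts. *)
Lemma diff_comp_near (R : realType) (U V W : normedModType R)
    (F : V -> W) (H : U -> V) (G : U -> W) (p : U) (q : V) (u : U) :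
  differentiable G p -> differentiable H p ->
  (\forall z \near p, G z = F (H z)) -> H p = q -> differentiable F q ->
  'd G p u = 'd F q ('d H p u).
Proof.
move=> dG dH GFH Hp; rewrite -Hp => dF.
rewrite -(deriveE _ dG) (near_eq_derive (g := F \o H)) //.
rewrite deriveE; last exact: differentiable_comp.
by rewrite diff_comp.
Qed.

Section ChartCalculus.
Variables (R : realType) (n : nat) (M : topologicalType).
Variable X : manifold R n M.
Implicit Types (i j k : mf_index X) (f h : M -> M) (x y : M).

Local Notation ch := (mf_chart X).

(** The differential of f at x, read in the charts i and j.  Tangent maps and
    changes of coordinates are instances of it: the latter are the case f = id. *)
Definition chart_diff i j f x : {linear 'rV[R]_n -> 'rV[R]_n} :=
  'd (chart_map (ch j) \o f \o chart_inv (ch i)) (chart_map (ch i) x).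

Lemma of_chartE i x u : of_chart i x u = chart_diff i (chart_at X x) id x u.
Proof. by []. Qed.

Lemma Ck_map1_id : Ck_map X 1 id.
Proof.
split; first by move=> x; exact: cvg_id.
by move=> i j; exact: (mf_compat i j 1%N).
Qed.

Lemma Ck_map21 f : Ck_map X 2 f -> Ck_map X 1 f.
Proof.
case=> cf hf; split=> // i j; have [h1 h2] := hf i j.
split=> // v x hx; have [h3 _] := h2 v.
exact/differentiable_continuous/h3.
Qed.

Lemma chart_differentiable f i j x : Ck_map X 1 f ->
  chart_dom (ch i) x -> chart_dom (ch j) (f x) ->
  differentiable (chart_map (ch j) \o f \o chart_inv (ch i)) (chart_map (ch i) x).
Proof. by case=> _ /(_ i j) [h _] hi hj; apply: h; exists x. Qed.

Lemma chart_derive_cont f i j x (v : 'rV[R]_n) : Ck_map X 1 f ->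
  chart_dom (ch i) x -> chart_dom (ch j) (f x) ->
  {for chart_map (ch i) x,
    continuous (fun z : 'rV[R]_n =>
      'D_v (chart_map (ch j) \o f \o chart_inv (ch i)) z)}.
Proof. by case=> _ /(_ i j) [_ h] hi hj; apply: h; exists x. Qed.

Lemma chart_diff_derive f i j x v : Ck_map X 1 f ->
  chart_dom (ch i) x -> chart_dom (ch j) (f x) ->
  chart_diff i j f x v =
   'D_v (chart_map (ch j) \o f \o chart_inv (ch i)) (chart_map (ch i) x).
Proof. by move=> hf hi hj; rewrite deriveE //; exact: chart_differentiable. Qed.

Lemma chart_inv_near i x (U : set M) : chart_dom (ch i) x -> nbhs x U ->
  \forall z \near chart_map (ch i) x, U (chart_inv (ch i) z).
Proof.
move=> hi hU; have := @chart_inv_cont _ _ _ (ch i) (chart_map (ch i) x).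
move=> /(_ (ex_intro2 _ _ x hi erefl)); apply.
by rewrite (chart_mapK hi).
Qed.

Lemma chart_map_near i x (U : set 'rV[R]_n) : chart_dom (ch i) x ->
  nbhs (chart_map (ch i) x) U -> \forall y \near x, U (chart_map (ch i) y).
Proof. by move=> hi hU; apply: (chart_map_cont hi). Qed.

Lemma chart_dom_near i x : chart_dom (ch i) x -> \forall y \near x, chart_dom (ch i) y.
Proof. by move=> hi; apply: open_nbhs_nbhs; split => //; exact: chart_dom_open. Qed.

Lemma chart_diff_comp f h i j k x u : Ck_map X 1 f -> Ck_map X 1 h ->
  Ck_map X 1 (f \o h) -> chart_dom (ch i) x -> chart_dom (ch j) (h x) ->
  chart_dom (ch k) (f (h x)) ->
  chart_diff i k (f \o h) x u = chart_diff j k f (h x) (chart_diff i j h x u).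
Proof.
move=> hf hh hfh hi hj hk.
have e : (chart_map (ch j) \o h \o chart_inv (ch i)) (chart_map (ch i) x) =
    chart_map (ch j) (h x) by rewrite /= (chart_mapK hi).
rewrite /chart_diff.
apply: (@diff_comp_near R _ _ _ (chart_map (ch k) \o f \o chart_inv (ch j))
  (chart_map (ch j) \o h \o chart_inv (ch i))
  (chart_map (ch k) \o (f \o h) \o chart_inv (ch i))
  _ _ u (chart_differentiable hfh hi hk)
  (chart_differentiable hh hi hj) _ e (chart_differentiable hf hj hk)).
have hjn : \forall y \near x, chart_dom (ch j) (h y).
  by apply: (hh.1 x); exact: chart_dom_near.
have := chart_inv_near hi hjn; apply: filterS => z hz.
by rewrite /= (chart_mapK hz).
Qed.

Lemma chart_diff_id i x u : chart_dom (ch i) x -> chart_diff i i id x u = u.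
Proof.
move=> hi; apply: (etrans (chart_diff_derive u Ck_map1_id hi hi)).
transitivity ('D_u id (chart_map (ch i) x) : 'rV[R]_n); last by rewrite derive_id.
apply: near_eq_derive.
have : nbhs (chart_map (ch i) x) (chart_map (ch i) @` chart_dom (ch i)).
  by apply: open_nbhs_nbhs; split; [exact: chart_cod_open|exists x].
by apply: filterS => z [y hy <-] /=; rewrite (chart_mapK hy).
Qed.

Lemma chart_diffK i j x u : chart_dom (ch i) x -> chart_dom (ch j) x ->
  chart_diff j i id x (chart_diff i j id x u) = u.
Proof.
move=> hi hj; have id1 := Ck_map1_id.
by rewrite -(@chart_diff_comp id id) ?chart_diff_id.
Qed.

Lemma mem_loc x : chart_dom (loc X x) x. Proof. exact: mem_chart_at. Qed.

(** The partial derivatives of f in the charts are continuous, hence bounded near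
    x, and they are the images of the basis vectors. *)
Lemma chart_diff_bound f i j x : Ck_map X 1 f ->
  chart_dom (ch i) x -> chart_dom (ch j) (f x) ->
  exists2 K : R, 0 < K & \forall y \near x, forall u,
    `|chart_diff i j f y u| <= K * `|u|.
Proof.
move=> hf hi hj; pose F := (chart_map (ch j) \o f \o chart_inv (ch i)).
pose K0 := \sum_(k < n) (`|'D_(delta_mx 0 k) F (chart_map (ch i) x)| + 1).
exists (n%:R * K0 + 1).
  by rewrite ltr_wpDl // mulr_ge0 //; apply: sumr_ge0 => k _; rewrite addr_ge0.
have hk (k : 'I_n) : \forall y \near x, `|chart_diff i j f y (delta_mx 0 k)| <= K0.
  have c : \forall z \near chart_map (ch i) x,
     `|'D_(delta_mx 0 k) F z| <= `|'D_(delta_mx 0 k) F (chart_map (ch i) x)| + 1.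
    have := @chart_derive_cont f i j x (delta_mx 0 k) hf hi hj.
    move=> /cvgr_distC_le /(_ _ ltr01); apply: filterS => z /= hz.
    rewrite -lerBlDl; apply: le_trans hz; exact: lerB_dist.
  have hjn : \forall y \near x, chart_dom (ch j) (f y).
    by apply: (hf.1 x); exact: chart_dom_near.
  near=> y; rewrite chart_diff_derive //.
  - apply: (@le_trans _ _ (`|'D_(delta_mx 0 k) F (chart_map (ch i) x)| + 1)).
      by near: y; exact: (chart_map_near hi c).
    rewrite /K0 (bigD1 k) //= lerDl; apply: sumr_ge0 => l _; exact: addr_ge0.
  - by near: y; exact: chart_dom_near.
  - by near: y.
have /filter_forall : forall k : 'I_n, \forall y \near x,
    `|chart_diff i j f y (delta_mx 0 k)| <= K0 by exact: hk.
apply: filterS => y hy u.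
apply: (le_trans (linear_rV_le hy u)).
by rewrite ler_wpM2r // lerDl.
Unshelve. all: by end_near. Qed.

End ChartCalculus.

(** * Comparison of the Riemannian norm with the norm in a chart *)

Section Metric.
Variables (R : realType) (n : nat) (M : ptopologicalType).
Variable X : riemannian R n M.
Implicit Types (i j k : mf_index X) (f h : M -> M) (x y : M).

Local Notation ch := (mf_chart X).

(** The Gram matrix of the metric at x in the coordinates of the chart i, while
    [rm_gram] refers to the preferred chart at x, which need not depend continuously
    on x. *)
Definition chart_gram i x : 'M[R]_n :=
  let B := lin1_mx (chart_diff i (chart_at X x) id x) in B *m rm_gram X x *m B^T.

Lemma chart_gramE i x u :
  qform (rm_gram X x) (of_chart i x u) = qform (chart_gram i x) u.
Proof.
rewrite /qform /chart_gram.
have -> : of_chart i x u = u *m lin1_mx (chart_diff i (chart_at X x) id x).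
  by rewrite mul_rV_lin1.
by rewrite trmx_mul !mulmxA.
Qed.

Lemma chart_gram_entry i x a b :
  chart_gram i x a b =
  (of_chart i x (delta_mx 0 a) *m rm_gram X x *m (of_chart i x (delta_mx 0 b))^T) 0 0.
Proof.
have e u : of_chart i x u = u *m lin1_mx (chart_diff i (chart_at X x) id x).
  by rewrite mul_rV_lin1.
rewrite !e /chart_gram trmx_mul !mulmxA.
set B := lin1_mx _.
have -> : delta_mx 0 a *m B *m rm_gram X x *m B^T = row a (B *m rm_gram X x *m B^T).
  by rewrite -!mulmxA -rowE.
by rewrite trmx_delta -colE !mxE.
Qed.

Lemma chart_gram_near i x (e : R) : 0 < e -> chart_dom (ch i) x ->
  \forall y \near x, forall a b, `|(chart_gram i y - chart_gram i x) a b| <= e.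
Proof.
move=> e0 hi.
have h a b : \forall y \near x, `|(chart_gram i y - chart_gram i x) a b| <= e.
  pose F (z : 'rV[R]_n) := chart_gram i (chart_inv (ch i) z) a b.
  have cF : {for chart_map (ch i) x, continuous F}.
    have -> : F = fun z => let y := chart_inv (ch i) z in
        (of_chart i y (delta_mx 0 a) *m rm_gram X y
           *m (of_chart i y (delta_mx 0 b))^T) 0 0.
      by apply/funext => z; exact: chart_gram_entry.
    have := @rm_smooth _ _ _ X i (delta_mx 0 a) (delta_mx 0 b) 0%N.
    by apply; exists x.
  have : \forall z \near chart_map (ch i) x, `|F z - F (chart_map (ch i) x)| <= e.
    by move/cvgr_distC_le : cF => /(_ _ e0); apply: filterS => z; rewrite distrC.
  move=> hF; have h1 := chart_map_near hi hF; have h2 := chart_dom_near hi.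
  near=> y.
  have hy : chart_dom (ch i) y by near: y.
  have : `|F (chart_map (ch i) y) - F (chart_map (ch i) x)| <= e by near: y.
  by rewrite subr_mxE /F (chart_mapK hy) (chart_mapK hi).
have h' : forall a, \forall y \near x, forall b, `|(chart_gram i y - chart_gram i x) a b| <= e.
  by move=> a; apply: filter_forall => b; exact: h.
exact: filter_forall.
Unshelve. all: by end_near. Qed.

Lemma tangent_normE i x u :
  tangent_norm X x (of_chart i x u) = Num.sqrt (qform (chart_gram i x) u).
Proof. by rewrite -chart_gramE. Qed.

Lemma chart_norm_upper i x : chart_dom (ch i) x ->
  exists2 K : R, 0 < K & \forall y \near x, forall u,
    tangent_norm X y (of_chart i y u) <= K * `|u|.
Proof.
move=> hi.
pose C := n%:R ^+ 2 * (1 + `|chart_gram i x|) + 1.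
have C0 : 0 < C by rewrite ltr_wpDl // mulr_ge0 ?exprn_ge0 // addr_ge0.
exists (Num.sqrt C); first by rewrite sqrtr_gt0.
have := chart_gram_near ltr01 hi; apply: filterS => y hy u.
rewrite tangent_normE -[`|u|]ger0_norm // -sqrtr_sqr -sqrtrM ?(ltW C0) //.
apply: ler_wsqrtr; apply: le_trans (ler_norm _) _.
apply: (@le_trans _ _ (n%:R ^+ 2 * (1 + `|chart_gram i x|) * `|u| ^+ 2)).
  apply: qform_le => a b.
  rewrite -[chart_gram i y](subrK (chart_gram i x)); set H := _ - _; rewrite [X in `|X|]mxE.
  apply: le_trans (ler_normD _ _) _; apply: lerD => //.
  by rewrite [leRHS]/Num.Def.normr /= mx_normrE; exact: (le_bigmax _ _ (a, b)).
by rewrite ler_wpM2r ?exprn_ge0 // lerDl.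
Qed.

Lemma of_chart_inj i x u : chart_dom (ch i) x -> of_chart i x u = 0 -> u = 0.
Proof.
rewrite of_chartE => hi h; rewrite -[u](chart_diffK u hi (mem_loc X x)).
by rewrite [X in chart_diff _ _ _ _ X]h linear0.
Qed.

Lemma chart_norm_lower i x : chart_dom (ch i) x ->
  exists2 c : R, 0 < c & \forall y \near x, forall u,
    c * `|u| <= tangent_norm X y (of_chart i y u).
Proof.
move=> hi.
have [u u0|c [e [c0 e0 hc]]] := @qform_pos_near _ _ (chart_gram i x).
  rewrite -chart_gramE; apply: rm_pos.
  by apply/eqP => h; move/eqP: u0; apply; exact: of_chart_inj h.
exists (Num.sqrt c); first by rewrite sqrtr_gt0.
have := chart_gram_near e0 hi; apply: filterS => y hy u.
rewrite tangent_normE -[`|u|]ger0_norm // -sqrtr_sqr -sqrtrM ?(ltW c0) //.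
by apply: ler_wsqrtr; exact: hc.
Qed.

Lemma tangent_map_comp f h x u : Ck_map X 1 f -> Ck_map X 1 h ->
  Ck_map X 1 (f \o h) ->
  tangent_map X (f \o h) x u = tangent_map X f (h x) (tangent_map X h x u).
Proof. by move=> hf hh hfh; apply: chart_diff_comp => //; exact: mem_loc. Qed.

Lemma tangent_map_id x u : tangent_map X id x u = u.
Proof. by apply: chart_diff_id; exact: mem_loc. Qed.

(** Near x, read f in a chart i at x and a chart j at f x: both Riemannian norms are
    comparable to the norm of the coordinates, uniformly, and the differential is
    bounded in coordinates. *)
Lemma tangent_bound_local f x : Ck_map X 1 f ->
  exists2 K : R, 0 < K & \forall y \near x, forall u,
    tangent_norm X (f y) (tangent_map X f y u) <= K * tangent_norm X y u.
Proof.
move=> hf; pose i := chart_at X x; pose j := chart_at X (f x).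
have hi : chart_dom (ch i) x := mem_loc X x.
have hj : chart_dom (ch j) (f x) := mem_loc X (f x).
have [K1 K10 hK1] := chart_norm_upper hj.
have [K2 K20 hK2] := chart_diff_bound hf hi hj.
have [c c0 hc] := chart_norm_lower hi.
exists (K1 * K2 / c); first by rewrite divr_gt0 // mulr_gt0.
have hfK1 := continuous_near (hf.1 x) hK1.
have hfj := continuous_near (hf.1 x) (chart_dom_near hj).
have hi' := chart_dom_near hi.
apply: filter_app hi'; apply: filter_app hc; apply: filter_app hK2.
apply: filter_app hfj; apply: filter_app hfK1.
apply: filterE => y h1 jy h2 h3 iy u.
pose w := chart_diff (chart_at X y) i id y u.
have uE : u = of_chart i y w by rewrite -(chart_diffK u (mem_loc X y) iy).
have -> : tangent_map X f y u = of_chart j (f y) (chart_diff i j f y w).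
  have -> : chart_diff i j f y w = chart_diff (chart_at X y) j f y u.
    by symmetry; exact: (chart_diff_comp u hf (Ck_map1_id X) hf (mem_loc X y) iy jy).
  exact: (chart_diff_comp u (Ck_map1_id X) hf hf (mem_loc X y) jy (mem_loc X (f y))).
apply: le_trans (h1 _) _; rewrite -!mulrA ler_pM2l //.
apply: le_trans (h2 _) _; rewrite ler_pM2l //.
by rewrite -ler_pdivrMl ?invr_gt0 // invrK [in leRHS]uE; exact: h3.
Qed.

Hypothesis hM : compact [set: M].

Lemma tangent_bound f : Ck_map X 1 f ->
  exists2 K : R, 0 < K & forall x u,
    tangent_norm X (f x) (tangent_map X f x u) <= K * tangent_norm X x u.
Proof.
move=> hf.
suff [K K0 hK] : exists2 K : R, 0 < K & forall x, [set: M] x -> forall u,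
    tangent_norm X (f x) (tangent_map X f x u) <= K * tangent_norm X x u.
  by exists K => // x; exact: hK.
apply: (compact_local_global (P := fun U => exists2 K : R, 0 < K & forall x, U x -> forall u,
    tangent_norm X (f x) (tangent_map X f x u) <= K * tangent_norm X x u)) => //.
- by exists 1.
- by move=> U V UV [K K0 hK]; exists K => // x /UV; exact: hK.
- move=> U V [K K0 hK] [L L0 hL]; exists (K + L); first exact: addr_gt0.
  move=> x [/hK|/hL] hx u; apply: le_trans (hx u) _; rewrite ler_wpM2r ?sqrtr_ge0 //.
    by rewrite lerDl ltW.
  by rewrite lerDr ltW.
- move=> x; have [K K0 hK] := tangent_bound_local x hf.
  by eexists; first exact: hK; exists K.
Qed.

End Metric.

(** * Straight segments in a chart *)

(** The integral of a nonnegative function is a supremum over the simple functions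
    below it, and a simple function below f is also below K. *)
Lemma ge0_integral01_le (R : realType) (f : R -> R) (K : R) :
  0 <= K -> (forall t, 0 <= f t <= K) ->
  (\int[lebesgue_measure]_(t in `[0%R, 1%R]) (f t)%:E <= K%:E)%E.
Proof.
move=> K0 hf.
apply: (@le_trans _ _ (\int[lebesgue_measure]_(t in `[0%R, 1%R]) (cst K%:E) (t : R))%E).
  rewrite integral_mkcond [leRHS]integral_mkcond.
  have h1 t : (0 <= ((fun t => (f t)%:E) \_ `[0%R, 1%R]) t)%E.
    by apply: erestrict_ge0 => u _; rewrite lee_fin; case/andP: (hf u).
  have h2 t : (0 <= ((cst K%:E : R -> \bar R) \_ `[0%R, 1%R]) t)%E.
    by apply: erestrict_ge0 => u _; rewrite lee_fin.
  rewrite !ge0_integralTE //; apply: le_ereal_sup => _ [h hle <-].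
  exists h => // t.
  apply: le_trans (hle t) _; apply: lee_restrict => u _ /=.
  by rewrite lee_fin; case/andP: (hf u).
rewrite integral_cst //= lebesgue_measure_itv /= lte_fin ltr01 -EFinB subr0.
by rewrite mule1.
Qed.

Section Segment.
Variable (R : realType).

(** The paths that define the Riemannian distance are C^1 on the whole of R, and
    not only on [0, 1].  A segment run through with this parameter stays
    between its end points, hence in the domain of a chart. *)
Definition ease (t : R) : R := (1 - cos (pi * t)) / 2.

Lemma ease01 t : 0 <= ease t <= 1.
Proof. by rewrite /ease; have := cos_le1 (pi * t); have := cos_geN1 (pi * t); lra. Qed.

Lemma ease0 : ease 0 = 0. Proof. by rewrite /ease mulr0 cos0 subrr mul0r. Qed.

Lemma ease1 : ease 1 = 1.
Proof. by rewrite /ease mulr1 cospi opprK divff. Qed.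

Definition ease_deriv (t : R) : R := pi / 2 * sin (pi * t).

Lemma is_derive_ease (t : R) : is_derive t 1 ease (ease_deriv t).
Proof.
have h1 : is_derive t 1 (fun t : R => pi * t) pi.
  by apply: is_derive_eq; exact: mulr1.
have h2 : is_derive t 1 (cos \o (fun t : R => pi * t)) (- sin (pi * t) * pi).
  exact: is_derive1_comp.
have -> : ease = 2^-1 \*: (cst 1 - (cos \o (fun t : R => pi * t))).
  by apply/funext => u; rewrite /ease /= mulrC.
by apply: is_derive_eq; rewrite /ease_deriv sub0r mulNr opprK /GRing.scale /=; lra.
Qed.

Lemma ease_deriv_bound t : `|ease_deriv t| <= pi.
Proof.
rewrite /ease_deriv normrM [X in X * _]ger0_norm ?divr_ge0 ?pi_ge0 //.
have := sin_max (pi * t); have := @pi_ge0 R => p0 s1.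
by apply: (@le_trans _ _ (pi / 2 * 1)); [rewrite ler_wpM2l ?divr_ge0|lra].
Qed.

Lemma ease_deriv_cont : continuous ease_deriv.
Proof.
move=> t; apply: (@continuousM _ _ (cst (pi / 2)) (sin \o (fun t => pi * t))).
  exact: cst_continuous.
apply: continuous_comp; last exact: continuous_sin.
by apply: (@continuousM _ _ (cst pi) id); [exact: cst_continuous|].
Qed.

Variable n : nat.
Implicit Types (a v : 'rV[R]_n).

Definition eased_line a v (t : R) := a + ease t *: v.

Lemma diff_ease (t : R) : differentiable ease t.
Proof. by apply/derivable1_diffP; case: (is_derive_ease t). Qed.

Lemma diff_easeE (t h : R) : 'd ease t h = h * ease_deriv t.
Proof.
rewrite -[h in LHS]mulr1 -[h * 1]/(h *: 1) linearZ /= -deriveE; last exact: diff_ease.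
by case: (is_derive_ease t) => _ ->.
Qed.

Lemma diff_line a v (t : R) : differentiable (eased_line a v) t.
Proof.
apply: differentiableD; first exact: differentiable_cst.
by apply: differentiableZl; exact: diff_ease.
Qed.

Lemma diff_lineE a v (t h : R) : 'd (eased_line a v) t h = (h * ease_deriv t) *: v.
Proof.
have dz : differentiable (fun z : R => ease z *: v) t.
  by apply: differentiableZl; exact: diff_ease.
have e0 := congr1 (@^~ h) (diffD (differentiable_cst a t) dz).
have e1 := congr1 (@^~ h) (@diff_cst R R 'rV[R]_n a t).
have e2 := congr1 (@^~ h) (diffZl v (diff_ease t)).
apply: (etrans e0); rewrite -[RHS]add0r; congr (_ + _); first exact: e1.
by apply: (etrans e2); rewrite diff_easeE.
Qed.

End Segment.

Section Curve.
Variables (R : realType) (n : nat) (M : ptopologicalType).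
Variable X : manifold R n M.
Implicit Types (j k : mf_index X).
Local Notation ch := (mf_chart X).
Variables (i : mf_index X) (a v : 'rV[R]_n).
Hypothesis hseg : forall t, (chart_map (ch i) @` chart_dom (ch i)) (eased_line a v t).

Definition chart_segment (t : R) : M := chart_inv (ch i) (eased_line a v t).

Lemma chart_segmentP t : chart_dom (ch i) (chart_segment t) /\
  chart_map (ch i) (chart_segment t) = eased_line a v t.
Proof. by have [w hw e] := hseg t; rewrite /chart_segment -e (chart_mapK hw). Qed.

Lemma chart_segment_cont : continuous chart_segment.
Proof.
move=> t; apply: (@continuous_comp _ _ _ (eased_line a v) (chart_inv (ch i))).
  exact/differentiable_continuous/diff_line.
exact: (chart_inv_cont (hseg t)).
Qed.

Lemma chart_segment_diff j t : chart_dom (ch j) (chart_segment t) ->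
  differentiable (chart_map (ch j) \o chart_segment) t /\
  forall h, 'd (chart_map (ch j) \o chart_segment) t h =
    (h * ease_deriv t) *: chart_diff i j id (chart_segment t) v.
Proof.
move=> hj; have [hi e] := chart_segmentP t.
have dT := chart_differentiable (Ck_map1_id X) hi hj.
have dL := diff_line a v t.
have dT' : differentiable (chart_map (ch j) \o id \o chart_inv (ch i)) (eased_line a v t).
  by rewrite -e.
split=> [|h]; first exact: (differentiable_comp dL dT').
apply: (etrans (congr1 (@^~ h) (diff_comp dL dT'))).
rewrite /comp diff_lineE /chart_diff e; exact: linearZZ.
Qed.

(** In any other chart j the path is the segment followed by the change of
    coordinates from i to j, which is C^1. *)
Lemma chart_segment_C1 : C1_curve X chart_segment.
Proof.
split; first exact: chart_segment_cont.
move=> j; split=> [t ht|h t ht]; first by case: (chart_segment_diff ht).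
have [hi e] := chart_segmentP t.
pose T := chart_map (ch j) \o id \o chart_inv (ch i).
pose G (u : R) := (h * ease_deriv u) *: ('D_v T (eased_line a v u)).
have hjn := continuous_near (@chart_segment_cont t) (chart_dom_near ht).
have hG : \forall u \near t, G u = 'D_h (chart_map (ch j) \o chart_segment) u.
  apply: filter_app hjn; apply: filterE => u hu.
  have [du e1] := chart_segment_diff hu.
  rewrite deriveE // e1 /G; congr (_ *: _).
  have [hi' e'] := chart_segmentP u.
  by rewrite -e' (chart_diff_derive _ (Ck_map1_id X) hi' hu).
have cG : {for t, continuous G}.
  apply: (@continuousZ _ _ _ (fun u => h * ease_deriv u)
    (fun u => 'D_v T (eased_line a v u))).
    apply: (@continuousM _ _ (cst h) (@ease_deriv R)); first exact: cst_continuous.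
    exact: ease_deriv_cont.
  apply: (@continuous_comp _ _ _ (eased_line a v) (fun z => 'D_v T z)).
    exact/differentiable_continuous/diff_line.
  by rewrite -e; exact: (chart_derive_cont (Ck_map1_id X) hi ht).
exact: near_eq_continuous hG cG.
Qed.

Lemma chart_segment_velocity t :
  velocity X chart_segment t = of_chart i (chart_segment t) (ease_deriv t *: v).
Proof.
have [dc e] := chart_segment_diff (mem_loc X (chart_segment t)).
by rewrite /velocity deriveE // e mul1r of_chartE linearZZ.
Qed.

End Curve.

(** * Packing numbers for the Riemannian distance *)

Section Distance.
Variables (R : realType) (n : nat) (M : ptopologicalType).
Variable X : riemannian R n M.
Implicit Types (i : mf_index X) (f h : M -> M) (x y : M).
Local Notation ch := (mf_chart X).

Lemma rm_dist_ge0 x y : (0 <= rm_dist X x y)%E.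
Proof.
apply: le_ereal_inf_tmp => _ [c _ <-]; apply: integral_ge0 => t _.
by rewrite lee_fin sqrtr_ge0.
Qed.

(** The distance is at most the length of the segment that joins y to z in a chart
    at x, and the Riemannian norm is at most K times the norm in this chart.  The
    constant pi bounds the speed of [ease]. *)
Lemma rm_dist_chart_local x : exists U (phi : M -> 'rV[R]_n) p (r K : R),
  [/\ nbhs x U, 0 <= r, 0 <= K, (forall y, U y -> `|phi y - p| <= r)
    & forall y z, U y -> U z -> (rm_dist X y z <= (K * `|phi z - phi y|)%:E)%E].
Proof.
pose i := chart_at X x; have hi : chart_dom (ch i) x := mem_loc X x.
pose p := chart_map (ch i) x.
have [K K0 hK] := chart_norm_upper hi.
have hcod : nbhs p (chart_map (ch i) @` chart_dom (ch i)).
  by apply: open_nbhs_nbhs; split; [exact: chart_cod_open|exists x].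
have [r r0 hr] : exists2 r : R, 0 < r & forall z, `|z - p| <= r ->
    (chart_map (ch i) @` chart_dom (ch i)) z /\
    forall u, tangent_norm X (chart_inv (ch i) z) (of_chart i (chart_inv (ch i) z) u)
              <= K * `|u|.
  have h := filterI hcod (chart_inv_near hi hK).
  have [r r0 hr] := (nbhs_ballP _ _).1 (h (nbhs_filter p)).
  exists (r / 2); first exact: divr_gt0.
  move=> z hz; apply: hr; rewrite -ball_normE /ball_ /= distrC.
  by apply: le_lt_trans hz _; rewrite ltr_pdivrMr // mulr2n mulrDr mulr1 ltrDl.
exists (chart_dom (ch i) `&` (fun y => `|chart_map (ch i) y - p| <= r)),
  (chart_map (ch i)), p, r, (K * pi).
split.
- apply: filterI; first exact: chart_dom_near.
  apply: (chart_map_near hi (U := fun z => `|z - p| <= r)).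
  apply/nbhs_ballP; exists r => // z; rewrite -ball_normE /ball_ /= distrC.
  exact: ltW.
- exact: ltW.
- by rewrite mulr_ge0 ?pi_ge0 // ltW.
- by move=> y [].
move=> y z [hy by_] [hz bz].
set a := chart_map (ch i) y; set v := chart_map (ch i) z - a.
have hball t : `|eased_line a v t - p| <= r.
  have /andP[e0 e1] := ease01 t.
  have -> : eased_line a v t - p =
      (1 - ease t) *: (a - p) + ease t *: (chart_map (ch i) z - p).
    rewrite /eased_line /v scalerBl scale1r !scalerBr.
    by apply/matrixP => k l; rewrite !mxE; ring.
  apply: le_trans (ler_normD _ _) _; rewrite !normrZ !ger0_norm ?subr_ge0 //.
  apply: (@le_trans _ _ ((1 - ease t) * r + ease t * r)).
    by apply: lerD; apply: ler_wpM2l; rewrite ?subr_ge0.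
  by rewrite -mulrDl subrK mul1r.
have hseg t : (chart_map (ch i) @` chart_dom (ch i)) (eased_line a v t).
  exact: (hr _ (hball t)).1.
apply: (@le_trans _ _ (curve_length X (chart_segment i a v))).
  apply: ereal_inf_lbound; exists (chart_segment i a v) => //; split.
  - exact: chart_segment_C1.
  - by rewrite /chart_segment /eased_line ease0 scale0r addr0 (chart_mapK hy).
  - by rewrite /chart_segment /eased_line ease1 scale1r addrC subrK (chart_mapK hz).
apply: ge0_integral01_le => [|t].
  by rewrite !mulr_ge0 ?pi_ge0 // ltW.
rewrite sqrtr_ge0 /= (chart_segment_velocity hseg).
apply: le_trans ((hr _ (hball t)).2 _) _.
rewrite -mulrA ler_pM2l // normrZ ler_wpM2r //; exact: ease_deriv_bound.
Qed.

Lemma rm_distxx x : rm_dist X x x = 0%E.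
Proof.
have [U [phi [p [r [K [Ux _ _ _ h]]]]]] := rm_dist_chart_local x.
apply/eqP; rewrite eq_le rm_dist_ge0 andbT.
have xU := nbhs_singleton Ux.
by apply: le_trans (h _ _ xU xU) _; rewrite subrr normr0 mulr0.
Qed.

(** The bound holds near each point by [rV_packing], since a chart shrinks
    distances by a bounded factor, and it is stable under finite unions. *)
Lemma rm_packing : compact [set: M] -> exists2 C : R, 0 < C &
  forall d : R, 0 < d -> d <= 1 -> forall s : seq M, uniq s ->
  (forall x y, x \in s -> y \in s -> x <> y -> (d%:E < rm_dist X x y)%E) ->
  (size s)%:R <= C / d ^+ n.
Proof.
move=> cM.
suff [C C0 hC] : exists2 C : R, 0 < C &
  forall d : R, 0 < d -> d <= 1 -> forall s : seq M, uniq s ->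
  (forall x, x \in s -> [set: M] x) ->
  (forall x y, x \in s -> y \in s -> x <> y -> (d%:E < rm_dist X x y)%E) ->
  (size s)%:R <= C / d ^+ n.
  by exists C => // d d0 d1 s us; exact: hC.
apply: (compact_local_global (P := fun U : set M => exists2 C : R, 0 < C &
  forall d : R, 0 < d -> d <= 1 -> forall s : seq M, uniq s ->
  (forall x, x \in s -> U x) ->
  (forall x y, x \in s -> y \in s -> x <> y -> (d%:E < rm_dist X x y)%E) ->
  (size s)%:R <= C / d ^+ n)) => //.
- exists 1 => // d d0 d1 [|x s] us hs _; last by case: (hs x); rewrite mem_head.
  by rewrite divr_ge0 // exprn_ge0 // ltW.
- move=> U V UV [C C0 hC]; exists C => // d d0 d1 s us hs.
  by apply: hC => // x /hs; exact: UV.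
- move=> U V [C C0 hC] [D D0 hD]; exists (C + D); first exact: addr_gt0.
  move=> d d0 d1 s us hs hd.
  pose s1 := [seq x <- s | `[< U x >]]; pose s2 := [seq x <- s | ~~ `[< U x >]].
  have -> : size s = (size s1 + size s2)%N.
    by rewrite !size_filter -(count_predC (fun x => `[< U x >])).
  rewrite natrD mulrDl; apply: lerD.
    apply: hC => //; first exact: filter_uniq.
      by move=> x; rewrite mem_filter => /andP[/asboolP].
    by move=> x y; rewrite !mem_filter => /andP[_ xs] /andP[_ ys]; exact: hd.
  apply: hD => //; first exact: filter_uniq.
    by move=> x; rewrite mem_filter => /andP[/asboolP Ux /hs [|]].
  by move=> x y; rewrite !mem_filter => /andP[_ xs] /andP[_ ys]; exact: hd.
- move=> x; have [U [phi [p [r [K [Ux r0 K0 hr hK]]]]]] := rm_dist_chart_local x.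
  (* The scale is d / (K + 1), since K may be 0. *)
  exists U => //; exists ((2 * r * (K + 1) + 1) ^+ n).
    by rewrite exprn_gt0 // ltr_wpDl // !mulr_ge0 // addr_ge0.
  move=> d d0 d1 s us hs hd.
  have K1 : 0 < K + 1 by rewrite ltr_wpDl.
  apply: le_trans (@rV_packing R n M s phi p r (d / (K + 1)) _ r0 us _ _) _.
  + exact: divr_gt0.
  + by move=> y /hs; exact: hr.
  + move=> y z ys zs yz; rewrite ltr_pdivrMr // mulrC distrC.
    have := lt_le_trans (hd _ _ ys zs yz) (hK _ _ (hs _ ys) (hs _ zs)).
    rewrite lte_fin => h; apply: lt_le_trans h _.
    by rewrite ler_wpM2r // lerDl.
  rewrite -expr_div_n; apply: lerXn2r; rewrite ?nnegrE.
  + by apply: addr_ge0 => //; apply: divr_ge0; [exact: mulr_ge0|apply: divr_ge0; exact: ltW].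
  + apply: divr_ge0; last exact: ltW.
    by apply: addr_ge0 => //; apply: mulr_ge0; [exact: mulr_ge0|exact: ltW].
  rewrite invf_div [leRHS]mulrDl mulrA lerD2l.
  by rewrite mul1r invf_ge1.
Qed.

End Distance.

(** * Vanishing of the entropy *)

Lemma sublinear_cvg0 (R : realType) (u : R^nat) :
  (forall e : R, 0 < e -> exists C : R, forall m, `|u m| <= C + e * m%:R) ->
  (fun m => m%:R^-1 * u m) @ \oo --> (0 : R).
Proof.
move=> hu; apply/cvgrPdist_le => e e0.
have [|C hC] := hu (e / 2); first exact: divr_gt0.
near=> m.
have m0 : 0 < m%:R :> R by rewrite ltr0n; near: m; exact: nbhs_infty_gt.
have hm : `|C| / (e / 2) <= m%:R by near: m; exact: nbhs_infty_ger.
rewrite sub0r normrN normrM normfV normr_nat mulrC ler_pdivrMr //.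
apply: le_trans (hC m) _; rewrite ler_pdivrMr ?divr_gt0 // in hm.
have := ler_norm C; lra.
Unshelve. all: by end_near. Qed.

Section Entropy.
Variables (R : realType) (n : nat) (M : ptopologicalType).
Variable X : riemannian R n M.

(** The Lipschitz constant is written e^L so that composition adds the values of
    L. *)
Definition exp_lipschitz (f : M -> M) (L : R) :=
  forall x y, (rm_dist X (f x) (f y) <= (expR L)%:E * rm_dist X x y)%E.

Lemma exp_lipschitz_mono f L L' : L <= L' -> exp_lipschitz f L -> exp_lipschitz f L'.
Proof.
move=> LL' h x y; apply: le_trans (h x y) _.
by apply: lee_wpmul2r; rewrite ?rm_dist_ge0 // lee_fin ler_expR.
Qed.

Lemma exp_lipschitz_comp f g L L' : exp_lipschitz f L -> exp_lipschitz g L' ->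
  exp_lipschitz (f \o g) (L + L').
Proof.
move=> hf hg x y; apply: le_trans (hf _ _) _.
rewrite expRD EFinM -muleA; apply: lee_wpmul2l; first by rewrite lee_fin expR_ge0.
exact: hg.
Qed.

Lemma exp_lipschitz_id : exp_lipschitz id 0.
Proof. by move=> x y; rewrite expR0 mul1e. Qed.

(** The quotients in the definition of Lipschitz maps take values in the extended
    reals: if d(x, y) = 0 then a finite quotient forces d(f x, f y) = 0, and if
    d(x, y) = +oo there is nothing to prove. *)
Lemma lipschitz_map_exp f : lipschitz_map X f -> exists L, exp_lipschitz f L.
Proof.
rewrite /lipschitz_map; set S := ereal_sup _ => hS.
have [K [K1 hK]] : exists K : R, 1 <= K /\ (S <= K%:E)%E.
  case: S hS => [r| |] // _.
    by exists (Num.max 1 r); rewrite le_max lexx lee_fin le_max lexx orbT.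
  by exists 1; split => //; exact: leNye.
have K0 : 0 < K by apply: lt_le_trans K1.
exists (ln K) => x y; rewrite lnK ?posrE //.
have [->|xy] := pselect (x = y); first by rewrite !rm_distxx mule0.
have : (rm_dist X (f x) (f y) / rm_dist X x y <= K%:E)%E.
  by apply: le_trans hK; apply: ereal_sup_ubound; exists (x, y).
have := rm_dist_ge0 X x y; have := rm_dist_ge0 X (f x) (f y).
move: (rm_dist X x y) (rm_dist X (f x) (f y)) => d d' d'0 d0.
case: d d0 => [r| |] //; last first.
  by move=> _ _; rewrite gt0_muley ?lte_fin // leey.
rewrite lee_fin le_eqVlt => /orP[/eqP <-|r0].
  rewrite inve0 mule0; move: d'0; rewrite le_eqVlt => /orP[/eqP <-//|d'0].
  by rewrite gt0_muley.
rewrite inver gt_eqF // => h.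
case: d' d'0 h => [r'| |] //.
  by rewrite -!EFinM !lee_fin => _; rewrite ler_pdivrMr.
by move=> _; rewrite gt0_mulye ?lte_fin ?invr_gt0.
Qed.

Hypothesis cM : compact [set: M].

(** An (m, r)-separated set is separated by min(1, r) e^(-L) for the distance, where
    e^L bounds the Lipschitz constants of the first m iterates; hence it has at most
    D (e^L / min(1, r))^n points. *)
Lemma separated_num_le f : (forall e : R, 0 < e -> exists C : R, forall m,
    exp_lipschitz (iter m f) (C + e * m%:R)) ->
  forall r e : R, 0 < r -> 0 < e -> exists C : R, forall m,
    (1 <= separated_num X f m r <= (expR (C + e * m%:R))%:E)%E.
Proof.
move=> hf r e r0 e0.
have [D D0 hD] := rm_packing X cM.
(* The exponent n of the packing bound multiplies the growth rate, which is
   divided in advance by n + 1, since n may be 0. *)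
have n1 : 0 < n.+1%:R :> R by rewrite ltr0n.
have [|C0 hC0] := hf (e / n.+1%:R); first exact: divr_gt0.
pose C := `|C0|; pose r1 := Num.min 1 r.
have r10 : 0 < r1 by rewrite lt_min ltr01 r0.
exists (ln D + n.+1%:R * C - n%:R * ln r1) => m.
apply/andP; split.
  apply: ereal_sup_ubound; exists [:: point] => //; split => // x y.
  by rewrite !inE => /eqP -> /eqP ->.
apply: ge_ereal_sup => _ [s [us hs] <-].
pose L := C + e / n.+1%:R * m%:R.
have L0 : 0 <= L.
  apply: addr_ge0; first exact: normr_ge0.
  by apply: mulr_ge0 => //; apply: divr_ge0 => //; exact: ltW.
have bd x y : (bowen_dist X f m x y <= (expR L)%:E * rm_dist X x y)%E.
  rewrite /bowen_dist; apply: bigmax_le => [|i _].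
    by apply: mule_ge0; [rewrite lee_fin expR_ge0|exact: rm_dist_ge0].
  apply: (exp_lipschitz_mono _ (hC0 i)).
  apply: lerD; first exact: ler_norm.
  by rewrite ler_pM2l ?divr_gt0 // ler_nat ltnW.
have := hD (r1 / expR L).
rewrite divr_gt0 ?expR_gt0 // ler_pdivrMr ?expR_gt0 // mul1r.
have -> : r1 <= expR L.
  apply: (@le_trans _ _ 1); first by rewrite ge_min lexx.
  by rewrite -expR0 ler_expR.
move=> /(_ isT isT s us) hsize; rewrite lee_fin.
apply: le_trans (hsize _) _.
  move=> x y xs ys xy; have := lt_le_trans (hs _ _ xs ys xy) (bd x y).
  move=> h; rewrite mulrC EFinM; have : (r1%:E < (expR L)%:E * rm_dist X x y)%E.
    by apply: le_lt_trans h; rewrite lee_fin ge_min lexx orbT.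
  rewrite -lte_pdivrMl ?expR_gt0 //.
rewrite -ler_ln ?posrE ?expR_gt0 ?divr_gt0 ?exprn_gt0 ?expR_gt0 //; last first.
  by rewrite divr_gt0 ?expR_gt0.
rewrite expRK ln_div ?posrE ?exprn_gt0 ?divr_gt0 ?expR_gt0 //.
rewrite lnXn ?divr_gt0 ?expR_gt0 // ln_div ?posrE ?expR_gt0 // expRK.
rewrite -mulr_natl.
have h1 : n%:R * L <= n.+1%:R * L by rewrite ler_wpM2r // ler_nat.
have h2 : n.+1%:R * L = n.+1%:R * C + e * m%:R.
  by rewrite /L mulrDr; congr (_ + _); field; rewrite lt0r_neq0.
by clear -h1 h2; lra.
Qed.

Theorem htop_subexp f : (forall e : R, 0 < e -> exists C : R, forall m,
    exp_lipschitz (iter m f) (C + e * m%:R)) -> htop X f = 0%E.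
Proof.
move=> hf.
have hS := separated_num_le hf.
have ent r : 0 < r -> entropy_at X f r = 0%E.
  move=> r0; pose u m := ln (fine (separated_num X f m r)).
  have fS m : separated_num X f m r \is a fin_num.
    have [C /(_ m)/andP[h1 h2]] := hS r 1 r0 ltr01.
    apply/fin_numPlt; apply/andP; split.
      by apply: lt_le_trans h1; exact: ltNyr.
    by apply: le_lt_trans h2 _; exact: ltry.
  have h1 m : 1 <= fine (separated_num X f m r).
    have [C /(_ m)/andP[h1 h2]] := hS r 1 r0 ltr01.
    by rewrite -lee_fin fineK.
  have uE m : ((m%:R^-1)%:E * lne (separated_num X f m r))%E = (m%:R^-1 * u m)%:E.
    rewrite -(fineK (fS m)) lne_EFin // ?fineK //.
    by apply: lt_le_trans (h1 m).
  have u0 : (fun m => m%:R^-1 * u m) @ \oo --> (0 : R).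
    apply: sublinear_cvg0 => e e0; have [C hC] := hS r e r0 e0.
    exists C => m; rewrite ger0_norm ?ln_ge0 //.
    rewrite -[leRHS]expRK ler_ln ?posrE ?expR_gt0 //.
      by rewrite -lee_fin fineK //; case/andP: (hC m).
    by apply: lt_le_trans (h1 m).
  rewrite /entropy_at (_ : (fun m => _) = (fun m => (m%:R^-1 * u m)%:E)); last first.
    by apply/funext => m; exact: uE.
  have v0 : (fun m => (m%:R^-1 * u m)%:E) @ \oo --> (0%:E : \bar R).
    by apply/fine_cvgP; split; [exact: nearW|exact: u0].
  by have [_ ->] := cvg_limn_einf_sup v0.
rewrite /htop; apply: lim_near_cst => //.
by near=> r; apply: ent; near: r; exact: nbhs_right_gt.
Unshelve. all: by end_near. Qed.

End Entropy.

(** * Vanishing of the Lyapunov exponents *)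

Section Lyapunov.
Variables (R : realType) (n : nat) (M : ptopologicalType).
Variable X : riemannian R n M.

Definition exp_stretch (f : M -> M) (L : R) := forall x u,
  tangent_norm X (f x) (tangent_map X f x u) <= expR L * tangent_norm X x u.

Lemma exp_stretch_mono f L L' : L <= L' -> exp_stretch f L -> exp_stretch f L'.
Proof.
move=> LL' h x u; apply: le_trans (h x u) _.
by rewrite ler_wpM2r ?sqrtr_ge0 // ler_expR.
Qed.

Lemma exp_stretch_comp f g L L' : Ck_map X 1 f -> Ck_map X 1 g ->
  Ck_map X 1 (f \o g) -> exp_stretch f L -> exp_stretch g L' ->
  exp_stretch (f \o g) (L + L').
Proof.
move=> cf cg cfg hf hg x u; rewrite tangent_map_comp //.
apply: le_trans (hf _ _) _.
by rewrite expRD -mulrA ler_wpM2l ?expR_ge0.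
Qed.

Lemma exp_stretch_id : exp_stretch id 0.
Proof. by move=> x u; rewrite tangent_map_id expR0 mul1r. Qed.

Lemma C1_exp_stretch f : compact [set: M] -> Ck_map X 1 f -> exists L, exp_stretch f L.
Proof.
move=> cM cf; have [K K0 hK] := tangent_bound cM cf.
by exists (ln K) => x u; rewrite lnK ?posrE.
Qed.

Lemma tangent_norm_gt0 x u : u <> 0 -> 0 < tangent_norm X x u.
Proof. by move=> /eqP u0; rewrite sqrtr_gt0; exact: rm_pos. Qed.

(** The bound on the derivative of h^m, applied to the image of u, bounds
    |D f^m u| from below. *)
Lemma lyapunov_subexp f h : cancel f h ->
  (forall m, Ck_map X 1 (iter m f)) -> (forall m, Ck_map X 1 (iter m h)) ->
  (forall e : R, 0 < e -> exists C : R, forall m,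
     exp_stretch (iter m f) (C + e * m%:R)) ->
  (forall e : R, 0 < e -> exists C : R, forall m,
     exp_stretch (iter m h) (C + e * m%:R)) ->
  forall x u, u <> 0 -> lyapunov_seq X f x u @ \oo --> (0 : R).
Proof.
move=> fK cf ch hf hh x u u0; apply: sublinear_cvg0 => e e0.
have [C hC] := hf e e0; have [D hD] := hh e e0.
have t0 := tangent_norm_gt0 x u0.
exists (`|C| + `|D| + `|ln (tangent_norm X x u)|) => m.
have fmK y : iter m h (iter m f y) = y.
  by elim: m y => //= m IH y; rewrite -iterS iterSr fK IH.
have e1 : iter m h \o iter m f = id by apply/funext => y; exact: fmK.
have hu : tangent_map X (iter m h) (iter m f x) (tangent_map X (iter m f) x u) = u.
  have cid : Ck_map X 1 (iter m h \o iter m f) by rewrite e1; exact: Ck_map1_id.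
  by rewrite -(tangent_map_comp _ _ (ch m) (cf m) cid) e1 tangent_map_id.
have h1 := hC m x u.
have h2 := hD m (iter m f x) (tangent_map X (iter m f) x u).
rewrite hu fmK in h2.
set t := tangent_norm X (iter m f x) _ in h1 h2 *.
move: h1 h2 t0; set s := tangent_norm X x u => h1 h2 s0.
have t0 : 0 < t.
  by rewrite -(pmulr_rgt0 _ (expR_gt0 (D + e * m%:R))); exact: lt_le_trans h2.
have l1 : ln t <= C + e * m%:R + ln s.
  rewrite -[X in X + ln s]expRK -lnM ?posrE ?expR_gt0 // ler_ln ?posrE //.
  by rewrite mulr_gt0 ?expR_gt0.
have l2 : ln s <= D + e * m%:R + ln t.
  rewrite -[X in X + ln t]expRK -lnM ?posrE ?expR_gt0 // ler_ln ?posrE //.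
  by rewrite mulr_gt0 ?expR_gt0.
rewrite ler_norml.
have := ler_norm C; have := ler_norm D; have := ler_norm (ln s).
have := lerNnormlW (lexx `|ln s|).
have := normr_ge0 C; have := normr_ge0 D.
clear -l1 l2; move: (e * m%:R) l1 l2 => w l1 l2; lra.
Qed.

End Lyapunov.

(** * Group actions *)

Section Action.
Variables (A : SL2Z) (M : Type) (rho : sdZ A -> M -> M).
Hypothesis hrho : is_action rho.

Lemma action_comp a b : rho (a * b)%g = rho a \o rho b.
Proof. by apply/funext => x; exact: hrho.2. Qed.

Lemma action_id : rho 1%g = id.
Proof. by apply/funext => x; exact: hrho.1. Qed.

Lemma action_iter (g : 'cV[int]_2) m :
  iter m (rho (sdZ_vec A g)) = rho (sdZ_vec A (g *+ m)).
Proof.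
elim: m => [|m IH]; first by rewrite mulr0n; exact: (esym action_id).
by rewrite mulrS sdZ_vecD action_comp -IH.
Qed.

End Action.

(* The hypothesis hAN is needed.  For A = -1 every nonzero g is an eigenvector *)
(* and |tr A| = 2, but, with B = [[2,1],[1,1]] and J = [[0,-1],[1,0]], one has *)
(* J B J^-1 = B^-1, so (a, b, k) |-> B^a J^k is an action of Z^2 ><|_A Z on    *)
(* the torus R^2/Z^2 by smooth Lipschitz diffeomorphisms in which (1, 0) acts  *)
(* by B, whose entropy and Lyapunov exponents are not 0.                       *)
Theorem corollary0p2 (R : realType) (n : nat) (M : ptopologicalType)
    (X : riemannian R n M) (hM : compact [set: M])
    (A : SL2Z) (hA1 : sl2_mx A <> 1%:M) (hAN : sl2_mx A <> - 1%:M)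
    (rho : sdZ A -> M -> M) (hrho : is_action rho)
    (g : 'cV[int]_2)
    (hg : 2 < `|\tr (sl2_mx A)| \/
          `|\tr (sl2_mx A)| = 2 /\ is_eigenvector A g) :
  ((forall a : sdZ A, lipschitz_homeo X (rho a)) ->
     htop X (rho (sdZ_vec A g)) = 0%E) /\
  ((forall a : sdZ A, Ck_diffeo X 2 (rho a)) ->
     zero_lyapunov_exponents X (rho (sdZ_vec A g))).
Proof.
split=> hX.
  apply: htop_subexp => // e e0.
  have bd : subadditive_bound (fun a L => exp_lipschitz X (rho a) L).
    split=> [|a b x y|a x y|a].
    - by rewrite action_id //; exact: exp_lipschitz_id.
    - by rewrite action_comp //; exact: exp_lipschitz_comp.
    - exact: exp_lipschitz_mono.
    - by have [h [_ _ _ _ /lipschitz_map_exp]] := hX a.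
  have [C hC] := distortion bd hA1 hAN hg e0.
  by exists C => m; rewrite action_iter.
have hC1 a : Ck_map X 1 (rho a).
  by have [h [_ _ /Ck_map21]] := hX a.
have bd : subadditive_bound (fun a L => exp_stretch X (rho a) L).
  split=> [|a b x y|a x y|a].
  - by rewrite action_id //; exact: exp_stretch_id.
  - rewrite action_comp //; apply: exp_stretch_comp => //.
    by rewrite -action_comp.
  - exact: exp_stretch_mono.
  - exact: C1_exp_stretch.
have hgN : 2 < `|\tr (sl2_mx A)| \/
    `|\tr (sl2_mx A)| = 2 /\ is_eigenvector A (- g).
  case: hg => [|[ht [g0 [s hs]]]]; [by left|right]; split=> //; split.
    by move=> h; apply: g0; rewrite -[g]opprK h oppr0.
  by exists s; rewrite mulmxN hs scalerN.
have cv x u : u <> 0 -> lyapunov_seq X (rho (sdZ_vec A g)) x u @ \oo --> (0 : R).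
  move=> u0; apply: (@lyapunov_subexp _ _ _ _ _ (rho (sdZ_vec A (- g)))) => //.
  - move=> y; rewrite -hrho.2 -sdZ_vecD addNr; exact: hrho.1.
  - by move=> m; rewrite action_iter.
  - by move=> m; rewrite action_iter.
  - move=> e e0; have [C hC] := distortion bd hA1 hAN hg e0.
    by exists C => m; rewrite action_iter.
  - move=> e e0; have [C hC] := distortion bd hA1 hAN hgN e0.
    by exists C => m; rewrite action_iter.
move=> mu _; split.
  exists setT; split=> [||x _ u u0]; first exact: measurableT.
    exact: probability_setT.
  by apply/cvg_ex; exists 0; exact: cv.
by move=> Gamma _ x _ u u0; apply: cvg_lim => //; exact: cv.
Qed.
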